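(* Let $C_N:E_N\to\mathcal K$ be a linear map from a finite-dimensional Hilbert space $E_N=V_0\oplus\cdots\oplus V_N$ (filtration-adapted orthogonal blocks) to a Hilbert space $\mathcal K$; no independence of its columns is assumed. Iterated block elimination (see context) gives $$G_N=C_N^*C_N=U_N^*D_NU_N,\qquad D_N=\operatorname{diag}(\mathfrak S_0,\dots,\mathfrak S_N)\ge0,$$ where $U_N$ is block upper triangular with identity diagonal blocks. Write $D_N^{\dagger/2}=(D_N^\dagger)^{1/2}$ (Moore--Penrose, zero on $\ker D_N$). For a linear target $L_N:E_N\to Z$ into a Banach space, $L_Nx$ can be recovered from $C_Nx$ exactly when $$\ker C_N\subset\ker L_N\quad\Longleftrightarrow\quad L_NU_N^{-1}|_{\ker D_N}=0.$$ Under this condition the least norm of a bounded linear decoder (a bounded linear $\mathscr D:\mathcal K\to Z$ with $\mathscr DC_N=L_N$) is $$\kappa_N(L_N)=\|L_NU_N^{-1}D_N^{\dagger/2}\|=\|L_NG_N^{\dagger/2}\|.$$ If the condition fails set $\kappa_N(L_N)=\infty$. With unrestricted $x\in E_N$ and deterministic data noise of norm at most $\delta>0$ in $\mathcal K$, the optimal worst-case target error over arbitrary decoders is $\delta\kappa_N(L_N)$; in the incompatible case even the noiseless worst-case error is infinite. Suppose in addition that the spaces $E_N$ increase with dense union in a Hilbert space $E$, and $C_N=J|_{E_N}$, $L_N=L|_{E_N}$ for bounded linear maps $J:E\to\mathcal K$, $L:E\to Z$. Then $L$ is stably recoverable from $J$ (i.e. $\|Lx\|\le C\|Jx\|$ for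 all $x\in E$ and some $C<\infty$) if and only if $\sup_N\kappa_N(L_N)<\infty$. The constants $\kappa_N(L_N)$ are nondecreasing in $N$; their supremum is the least global decoder norm, and multiplying it by $\delta>0$ gives the unrestricted deterministic noise risk for recovering $Lx$ from $Jx$ with noise of norm at most $\delta$.
   Context: Iterated block elimination: writing $G_n=C_n^*C_n$ for the Gram matrix of the restriction $C_n=C_N|_{V_0\oplus\cdots\oplus V_n}$ in block form $G_n=\begin{pmatrix}G_{n-1} & B_n \\ B_n^* & \Gamma_n\end{pmatrix}$, positivity gives $\operatorname{ran}B_n\subset\operatorname{ran}G_{n-1}$; put $L^{(n)}=G_{n-1}^\dagger B_n$ and $\mathfrak S_n=\Gamma_n-B_n^*G_{n-1}^\dagger B_n$ (equivalently $\mathfrak S_n=W_n^*(I-P_{n-1})W_n$ with $W_n=C_N|_{V_n}$ and $P_{n-1}$ the orthogonal projection onto $C_N(V_0\oplus\cdots\oplus V_{n-1})$; $\mathfrak S_0=G_0$). Then $G_n=\begin{pmatrix}I & L^{(n)} \\ 0 & I\end{pmatrix}^*\begin{pmatrix}G_{n-1} & 0 \\ 0 & \mathfrak S_n\end{pmatrix}\begin{pmatrix}I & L^{(n)} \\ 0 & I\end{pmatrix}$, and $U_n=\begin{pmatrix}U_{n-1} & 0 \\ 0 & I\end{pmatrix}\begin{pmatrix}I & L^{(n)} \\ 0 & I\end{pmatrix}$, $U_0=I$. The worst-case error of a (not necessarily linear) decoder $\widehat D:\mathcal K\to Z$ is $\sup_{x,\ \|e\|\le\delta}\|\widehat D(C_Nx+e)-L_Nx\|$.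 *)

(* Defs.v *)
From HB Require Import structures.
From mathcomp Require Import all_boot all_order all_algebra.
From mathcomp Require Import sesquilinear complex.
From mathcomp Require Import boolp classical_sets functions reals ereal.
From mathcomp Require Import topology normedtype sequences.

Set Implicit Arguments.
Unset Strict Implicit.
Unset Printing Implicit Defensive.

Import Order.TTheory GRing.Theory Num.Theory.
Import numFieldNormedType.Exports.

Local Open Scope classical_set_scope.
Local Open Scope ring_scope.

(* Hilbert and Banach spaces are taken over either the real or the complex
   numbers. *)
Inductive field_kind := RealField | ComplexField.

Definition base_field (R : realType) (k : field_kind) : numFieldType :=
  match k with
  | RealField => (R : numFieldType)
  | ComplexField => (R[i] : numFieldType)
  end.

Definition field_conj (R : realType) (k : field_kind) :
    base_field R k -> base_field R k :=
  match k return base_field R k -> base_field R k with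
  | RealField => id
  | ComplexField => @conjc R
  end.
Arguments field_conj : clear implicits.

Definition field_re (R : realType) (k : field_kind) : base_field R k -> R :=
  match k return base_field R k -> R with
  | RealField => id
  | ComplexField => @complex.Re R
  end.

Section Norms.
Context (R : realType) (k : field_kind).
Local Notation F := (base_field R k).

(* In a normedModType F the norm lies in F (with zero imaginary part when F is
   complex); rnorm is the same number seen in R. *)
Definition rnorm (V : normedModType F) (x : V) : R := field_re `|x|.

Definition dotnorm (V : lmodType F) (d : {dot V for field_conj R k}) (x : V)
    : R :=
  Num.sqrt (field_re (d x x)).

(* A Hilbert space is a complete normed space H with an inner product d (linear
   in its first argument) such that hilbert_norm d. *)
Definition hilbert_norm (H : normedModType F) (d : {dot H for field_conj R k})
    : Prop :=
  forall x, `|x| ^+ 2 = d x x.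

(* The norm of f as an operator, for the norms nU and nV; +oo if f is
   unbounded. *)
Definition opnorm (U V : lmodType F) (nU : U -> R) (nV : V -> R) (f : U -> V)
    : \bar R :=
  ereal_sup [set (nV (f x))%:E | x in [set x | nU x <= 1]].

Definition bounded_op (U V : normedModType F) (f : U -> V) : Prop :=
  (opnorm (@rnorm U) (@rnorm V) f < +oo)%E.

End Norms.

Section Adjoint.
Context (R : realType) (k : field_kind).
Local Notation F := (base_field R k).

(* Evaluated only on linear f with E finite-dimensional, where the
   representing vector z exists and is unique. *)
Definition adjoint (E : vectType F) (H : lmodType F)
    (dE : {dot E for field_conj R k}) (dH : {dot H for field_conj R k})
    (f : E -> H) (y : H) : E :=
  xget 0 [set z | forall x, dH (f x) y = dE x z].

Context (E : vectType F) (dE : {dot E for field_conj R k}).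

Definition adj (A : 'End(E)) : 'End(E) := linfun (adjoint dE dE A).

Definition selfadjoint (A : 'End(E)) : Prop :=
  forall x y, dE (A x) y = dE x (A y).

(* In a numFieldType, 0 <= z means that z is real and nonnegative. *)
Definition psd (A : 'End(E)) : Prop :=
  selfadjoint A /\ forall x, 0 <= dE (A x) x.

Definition penrose (A X : 'End(E)) : Prop :=
  [/\ (A \o X \o A)%VF = A, (X \o A \o X)%VF = X,
      selfadjoint (A \o X)%VF & selfadjoint (X \o A)%VF].

Definition pinv (A : 'End(E)) : 'End(E) := xget 0 [set X | penrose A X].

Definition psd_sqrt (A : 'End(E)) : 'End(E) :=
  xget 0 [set S | psd S /\ (S \o S)%VF = A].

Definition pinv_half (A : 'End(E)) : 'End(E) := psd_sqrt (pinv A).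

Definition gram (H : lmodType F) (dH : {dot H for field_conj R k})
    (C : E -> H) : 'End(E) :=
  linfun (adjoint dE dH C \o C).

End Adjoint.

(* E is the orthogonal direct sum of V 0, ..., V N (the values of V beyond N are
   irrelevant, and blocks may be zero). *)
Definition orthogonal_blocks (R : realType) (k : field_kind)
    (E : vectType (base_field R k)) (dE : {dot E for field_conj R k}) (N : nat)
    (V : nat -> {vspace E}) : Prop :=
  (forall i j : nat, (i <= N)%N -> (j <= N)%N -> i != j ->
     forall u v, u \in V i -> v \in V j -> dE u v = 0) /\
  (\sum_(i < N.+1) V i)%VS = fullv.

(* A linear map between sums of blocks is represented by an endomorphism of E:
   it is extended by 0 to the remaining blocks, except for blockU, which is
   extended by the identity. *)
Section BlockElimination.
Context (R : realType) (k : field_kind).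
Local Notation F := (base_field R k).
Context (E : vectType F) (dE : {dot E for field_conj R k}).
Context (H : lmodType F) (dH : {dot H for field_conj R k}).
Context (N : nat) (V : nat -> {vspace E}) (C : E -> H).

(* Projection onto V i along the sum of the other blocks. *)
Definition bproj (i : nat) : 'End(E) :=
  daddv_pi (V i) (\sum_(j < N.+1 | (j : nat) != i) V j)%VS.

(* Projection onto V 0 + ... + V (n - 1) along the remaining blocks. *)
Definition bproj_lt (n : nat) : 'End(E) := \sum_(i < n) bproj i.

(* The Gram matrix of the restriction of C to V 0 + ... + V (n - 1): it is
   called G_(n-1) in the usual indexing, and is 0 for n = 0. *)
Definition gram_lt (n : nat) : 'End(E) := gram dE dH (C \o bproj_lt n).

Definition blockB (n : nat) : 'End(E) :=
  (bproj_lt n \o gram_lt n.+1 \o bproj n)%VF.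

Definition blockGamma (n : nat) : 'End(E) :=
  (bproj n \o gram_lt n.+1 \o bproj n)%VF.

Definition blockL (n : nat) : 'End(E) :=
  (pinv dE (gram_lt n) \o blockB n)%VF.

(* Since blockB 0 = 0, blockS 0 is G_0. *)
Definition blockS (n : nat) : 'End(E) :=
  blockGamma n - (adj dE (blockB n) \o pinv dE (gram_lt n) \o blockB n)%VF.

Fixpoint blockU (n : nat) : 'End(E) :=
  if n is m.+1 then (blockU m \o (\1 + blockL n))%VF else \1%VF.

Definition blockD : 'End(E) := \sum_(n < N.+1) blockS n.

End BlockElimination.

Section Recovery.
Context (R : realType) (k : field_kind).
Local Notation F := (base_field R k).

Definition ker_sub (E H Z : lmodType F) (C : E -> H) (L : E -> Z) : Prop :=
  forall x, C x = 0 -> L x = 0.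

Definition exactly_recoverable (E H Z : lmodType F) (C : E -> H) (L : E -> Z)
    : Prop :=
  exists f : H -> Z, forall x, f (C x) = L x.

Definition kappa (E : vectType F) (dE : {dot E for field_conj R k})
    (H : normedModType F) (dH : {dot H for field_conj R k})
    (Z : normedModType F) (C : E -> H) (L : E -> Z) : \bar R :=
  if `[< ker_sub C L >]
  then opnorm (dotnorm dE) (@rnorm R k Z) (L \o pinv_half dE (gram dE dH C))
  else +oo%E.

(* Norms of the bounded linear decoders recovering L x from C x. *)
Definition decoder_norms (E : lmodType F) (H Z : normedModType F)
    (C : E -> H) (L : E -> Z) : set (\bar R) :=
  [set a | exists D : {linear H -> Z},
     [/\ bounded_op D, forall x, D (C x) = L x
       & a = opnorm (@rnorm R k H) (@rnorm R k Z) D]].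

Definition is_least (A : set (\bar R)) (a : \bar R) : Prop :=
  A a /\ forall b, A b -> (a <= b)%E.

(* The domain E of x is unrestricted, and the decoder Dec is arbitrary. *)
Definition worst_error (E : lmodType F) (H Z : normedModType F)
    (C : E -> H) (L : E -> Z) (delta : R) (Dec : H -> Z) : \bar R :=
  ereal_sup [set (rnorm (Dec (C p.1 + p.2) - L p.1))%:E
            | p in [set p : E * H | rnorm p.2 <= delta]].

Definition optimal_error (E : lmodType F) (H Z : normedModType F)
    (C : E -> H) (L : E -> Z) (delta : R) : \bar R :=
  ereal_inf (range (worst_error C L delta)).

Definition stably_recoverable (E : lmodType F) (H Z : normedModType F)
    (J : E -> H) (L : E -> Z) : Prop :=
  exists c : R, forall x, rnorm (L x) <= c * rnorm (J x).

End Recovery.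

(* Main.v *)
Require Import Defs.
From HB Require Import structures.
From mathcomp Require Import all_boot all_order all_algebra.
From mathcomp Require Import sesquilinear complex.
From mathcomp Require Import boolp classical_sets functions reals ereal.
From mathcomp Require Import topology normedtype sequences.
From mathcomp Require Import ring.

Set Implicit Arguments.
Unset Strict Implicit.
Unset Printing Implicit Defensive.

Import Order.TTheory GRing.Theory Num.Theory.
Import numFieldNormedType.Exports.

Local Open Scope classical_set_scope.
Local Open Scope ring_scope.

(**
Everything rests on one description of the optimal linear decoders. Let T be
an endomorphism of the finite-dimensional space E such that C T is a
contraction and L T T* C* C = L. Then L T T* C* is a decoder. Its norm is at
most that of L T, because T* C* is a contraction as the adjoint of one; and
each decoder K has norm at least that of L T, because L T = K C T. So the least
decoder norm is the norm of L T ([least_decoder]). The two formulas for kappa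
are the cases T = G^(dagger/2) and T = U^-1 D^(dagger/2) ([kappa_least],
[kappa_block]). In both, C T is a contraction since A^(dagger/2) A A^(dagger/2)
is an orthogonal projection for each positive A, and L T T* C* C = L expresses
that L vanishes on the kernel of C.

The pseudo-inverse of a positive A and its square root are obtained from an
orthonormal basis of eigenvectors ([spectral_theorem]), so that a single
argument serves both scalar fields; only the factorization of polynomials
([poly_factor]) distinguishes them.

The block factorization is a Schur complement step, iterated. The range of
B_n lies in the range of G_(n-1), hence G_(n-1) L_n = B_n, and expanding
(1 + L_n)* (G_(n-1) + S_n) (1 + L_n) gives G_n ([block_step]). The rest is
bookkeeping: L_n maps block n into the earlier blocks and kills all other
blocks.

The noise risk is bounded below by comparing the signals x and -x with the
noises - C x and C x, which produce the same data 0: no decoder does better than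
the norm of L x, for any x with C x of norm at most delta. A linear decoder of
norm kappa attains delta kappa.

In the infinite-dimensional statement only the existence of a decoder of norm
s = sup_N kappa_N is delicate. Let P_n be the orthogonal projection of the data
space onto J(E_n), and let D_n y be the value of L at a point of E_n that J maps
to P_n y; D_n is the optimal decoder at level n. The norms of P_n y increase and
are bounded, so (P_n y) is Cauchy by Pythagoras. Since D_m y - D_n y is the
value of L at a point that J maps to P_m y - P_n y, the sequence (D_n y) is
Cauchy too, and its limit is the required decoder ([limit_decoder]). It
recovers L on the union of the E_n, hence on E by density.
*)

(** * Real and complex scalars *)

Section Scalars.
Context (R : realType) (k : field_kind).
Local Notation F := (base_field R k).
Implicit Types (r s : R) (z w : F).

Definition rincl : R -> F :=
  match k return R -> base_field R k with
  | RealField => id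
  | ComplexField => real_complex R
  end.

Lemma rincl_re r : field_re (rincl r) = r.
Proof. by rewrite /rincl; case: k. Qed.

Lemma rinclD r s : rincl (r + s) = rincl r + rincl s.
Proof. by rewrite /rincl; case: k => //=; rewrite rmorphD. Qed.

Lemma rinclM r s : rincl (r * s) = rincl r * rincl s.
Proof. by rewrite /rincl; case: k => //=; rewrite rmorphM. Qed.

Lemma rincl0 : rincl 0 = 0.
Proof. by rewrite /rincl; case: k. Qed.

Lemma rincl1 : rincl 1 = 1.
Proof. by rewrite /rincl; case: k. Qed.

Lemma rincl_eq0 r : (rincl r == 0) = (r == 0).
Proof.
rewrite -rincl0; apply/eqP/eqP => [/(congr1 (@field_re R k))|->//].
by rewrite !rincl_re.
Qed.

Lemma rincl_le r s : (rincl r <= rincl s) = (r <= s).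
Proof. by rewrite /rincl; case: k => //=; rewrite lecR. Qed.

Lemma rincl_lt r s : (rincl r < rincl s) = (r < s).
Proof. by rewrite /rincl; case: k => //=; rewrite ltcR. Qed.

Lemma ge0_rincl z : 0 <= z -> z = rincl (field_re z).
Proof.
rewrite /rincl; move: z; case: k => //= z z0.
by rewrite RRe_real// ger0_real.
Qed.

Lemma field_conjD z w :
  field_conj R k (z + w) = field_conj R k z + field_conj R k w.
Proof. by move: z w; case: k => //= z w; rewrite rmorphD. Qed.

Lemma field_conjN z : field_conj R k (- z) = - field_conj R k z.
Proof. by move: z; case: k => //= z; rewrite rmorphN. Qed.

Lemma field_conjM z w :
  field_conj R k (z * w) = field_conj R k z * field_conj R k w.
Proof. by move: z w; case: k => //= z w; rewrite rmorphM. Qed.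

Lemma field_conjK z : field_conj R k (field_conj R k z) = z.
Proof. by move: z; case: k => //= z; rewrite conjcK. Qed.

Lemma field_conj_rincl r : field_conj R k (rincl r) = rincl r.
Proof. by rewrite /rincl; case: k => //; exact: conjc_real. Qed.

Lemma field_conj0 : field_conj R k 0 = 0.
Proof. by rewrite -rincl0 field_conj_rincl. Qed.

Lemma field_conj_id z : field_conj R k z = z -> z = rincl (field_re z).
Proof.
rewrite /rincl; move: z; case: k => //= -[a b] [/eqP].
by rewrite /real_complex_def/= eq_sym -addr_eq0 -mulr2n mulrn_eq0 /= => /eqP ->.
Qed.

Lemma mulr_conj z : z * field_conj R k z = `|z| ^+ 2.
Proof.
move: z; case: k => /= z; last by rewrite sqr_normc.
by rewrite real_normK ?num_real// expr2.
Qed.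

End Scalars.
Arguments rincl {R k} r.

(** * Inner products and norms *)

Section Dots.
Context (R : realType) (k : field_kind).
Local Notation F := (base_field R k).
Context (V : lmodType F) (d : {dot V for field_conj R k}).

Lemma dotDl x y z : d (x + y) z = d x z + d y z.
Proof. exact: linearDl. Qed.
Lemma dotDr x y z : d x (y + z) = d x y + d x z.
Proof. exact: linearDr. Qed.
Lemma dotBl x y z : d (x - y) z = d x z - d y z.
Proof. exact: linearBl. Qed.
Lemma dotBr x y z : d x (y - z) = d x y - d x z.
Proof. exact: linearBr. Qed.
Lemma dot0l x : d 0 x = 0.
Proof. exact: linear0l. Qed.
Lemma dot0r x : d x 0 = 0.
Proof. exact: linear0r. Qed.
Lemma dotZl a x y : d (a *: x) y = a * d x y.
Proof. exact: linearZl_LR. Qed.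
Lemma dotZr a x y : d x (a *: y) = field_conj R k a * d x y.
Proof. exact: linearZr_LR. Qed.
Lemma dot_suml (I : Type) (s : seq I) (P : pred I) (f : I -> V) y :
  d (\sum_(i <- s | P i) f i) y = \sum_(i <- s | P i) d (f i) y.
Proof. exact: linear_sumlz. Qed.
Lemma dot_sumr (I : Type) (s : seq I) (P : pred I) (f : I -> V) y :
  d y (\sum_(i <- s | P i) f i) = \sum_(i <- s | P i) d y (f i).
Proof. exact: linear_sumr. Qed.
Lemma dotC x y : d x y = field_conj R k (d y x).
Proof. by rewrite [LHS]hermitian_subproof expr0 mul1r. Qed.
Lemma dot_gt0 x : x != 0 -> 0 < d x x.
Proof. exact: neq0_dnorm_gt0. Qed.
Lemma dot_ge0 x : 0 <= d x x.
Proof. by have [->|/dot_gt0/ltW//] := eqVneq x 0; rewrite dot0l. Qed.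
Lemma dot_eq0 x : d x x = 0 -> x = 0.
Proof. by move=> h; apply/eqP; apply/negPn/negP => /dot_gt0; rewrite h ltxx. Qed.
End Dots.

Section RealNorms.
Context (R : realType) (k : field_kind).
Local Notation F := (base_field R k).

Section RNorm.
Context (V : normedModType F).
Implicit Types x y : V.

Lemma rnormE x : `|x| = rincl (rnorm x).
Proof. exact/ge0_rincl/normr_ge0. Qed.

Lemma rnorm_ge0 x : 0 <= rnorm x.
Proof. by rewrite -(@rincl_le R k) rincl0 -rnormE. Qed.

Lemma rnorm0 : rnorm (0 : V) = 0.
Proof. by rewrite /rnorm normr0 -(rincl0 R k) rincl_re. Qed.

Lemma rnorm_eq0 x : rnorm x = 0 -> x = 0.
Proof. by move=> x0; apply/normr0_eq0; rewrite rnormE x0 rincl0. Qed.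

Lemma rnormN x : rnorm (- x) = rnorm x.
Proof. by rewrite /rnorm normrN. Qed.

Lemma rnormBC x y : rnorm (x - y) = rnorm (y - x).
Proof. by rewrite -rnormN opprB. Qed.

Lemma rnorm_triangle x y : rnorm (x + y) <= rnorm x + rnorm y.
Proof. by rewrite -(@rincl_le R k) rinclD -!rnormE ler_normD. Qed.

Lemma rnormZ (a : R) x : 0 <= a -> rnorm (rincl a *: x) = a * rnorm x.
Proof.
move=> a0; rewrite {1}/rnorm normrZ ger0_norm ?rnormE -?rinclM ?rincl_re//.
by rewrite -(rincl0 R k) rincl_le.
Qed.

End RNorm.

Section DotNorm.
Context (V : lmodType F) (d : {dot V for field_conj R k}).

Lemma dot_rincl x : d x x = rincl (field_re (d x x)).
Proof. exact/ge0_rincl/dot_ge0. Qed.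

Lemma dot_re_ge0 x : 0 <= field_re (d x x).
Proof. by rewrite -(@rincl_le R k) rincl0 -dot_rincl dot_ge0. Qed.

Lemma dotnorm_ge0 x : 0 <= dotnorm d x.
Proof. exact: sqrtr_ge0. Qed.

Lemma dotnorm_sqr x : dotnorm d x ^+ 2 = field_re (d x x).
Proof. by rewrite sqr_sqrtr ?dot_re_ge0. Qed.

Lemma dotnorm_le x (a : R) : 0 <= a ->
  (dotnorm d x <= a) = (field_re (d x x) <= a ^+ 2).
Proof. by move=> a0; rewrite -dotnorm_sqr ler_pXn2r ?nnegrE ?dotnorm_ge0. Qed.

Lemma dot_pythagoras x y : d x y = 0 -> d (x + y) (x + y) = d x x + d y y.
Proof.
by move=> xy; rewrite dotDl !dotDr xy (dotC d y) xy field_conj0 addr0 add0r.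
Qed.
End DotNorm.

Lemma hilbert_rnorm (H : normedModType F) (dH : {dot H for field_conj R k}) :
  hilbert_norm dH -> @rnorm R k H =1 dotnorm dH.
Proof.
move=> hH x; apply/eqP; rewrite -(@eqrXn2 _ 2) ?rnorm_ge0 ?dotnorm_ge0// dotnorm_sqr.
by rewrite -hH rnormE !expr2 -rinclM rincl_re.
Qed.

End RealNorms.

(** * Adjoints in finite dimension *)

Section LinearOf.
Context (F : numFieldType) (U V : lmodType F).
Definition linear_of (f : U -> V) (lf : linear f) : {linear U -> V} :=
  HB.pack f (GRing.isLinear.Build F U V _ f lf).
End LinearOf.

Section FinDim.
Context (R : realType) (k : field_kind).
Local Notation F := (base_field R k).
Context (E : vectType F) (dE : {dot E for field_conj R k}).

Lemma dot_ext x y : (forall z, dE z x = dE z y) -> x = y.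
Proof.
move=> h; apply/eqP; rewrite -subr_eq0; apply/eqP/(@dot_eq0 _ _ _ dE).
by rewrite dotBr h subrr.
Qed.

Definition dot_row (n : nat) (e : nat -> E) (x : E) : 'rV[F]_n :=
  \row_i dE x (e i).

Lemma dot_row_linear n e : linear (@dot_row n e).
Proof. by move=> a x y; apply/rowP => i; rewrite !mxE dotDl dotZl. Qed.

Definition dot_rowf n e : 'Hom(E, 'rV[F]_n) :=
  linfun (linear_of (@dot_row_linear n e)).

Lemma dot_rowfE n e x : dot_rowf n e x = dot_row n e x.
Proof. by rewrite lfunE. Qed.

(** By definiteness, pairing with a basis is an injective linear map from E to
the rows of length dim E, hence onto: some z has prescribed pairings with the
basis. *)
Lemma riesz (phi : E -> F) :
  (forall a x y, phi (a *: x + y) = a * phi x + phi y) ->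
  exists z, forall x, phi x = dE x z.
Proof.
move=> lphi.
pose n := \dim {:E}; pose e i := (vbasis {:E})`_i.
have eE x : exists c : 'I_n -> F, x = \sum_i c i *: e i.
  by exists (fun i => coord (vbasis fullv) i x); apply: coord_vbasis; rewrite memvf.
have phiE (c : 'I_n -> F) : phi (\sum_i c i *: e i) = \sum_i c i * phi (e i).
  pose phil := linear_of (lphi : linear (phi : E -> F^o)).
  have -> : phi = phil by [].
  by rewrite linear_sum; apply: eq_bigr => i _; rewrite linearZ.
have ker0 : lker (dot_rowf n e) == 0%VS.
  rewrite -subv0; apply/subvP => x; rewrite memv_ker dot_rowfE memv0 => /eqP x0.
  apply/eqP/(@dot_eq0 _ _ _ dE); have [c {2}->] := eE x.
  rewrite dot_sumr big1// => i _; have /rowP/(_ i) := x0.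
  by rewrite !mxE dotZr => ->; rewrite mulr0.
have : \dim (limg (dot_rowf n e)) = n by rewrite limg_dim_eq// capfv; apply/eqP.
move=> dimn; have full : limg (dot_rowf n e) = fullv.
  by apply/eqP; rewrite eqEdim subvf dimn dimvf /dim/= mul1n leqnn.
have : (\row_i field_conj R k (phi (e i)) : 'rV[F]_n) \in limg (dot_rowf n e).
  by rewrite full memvf.
case/memv_imgP => z _; rewrite dot_rowfE => zE; exists z => x.
have [c ->] := eE x; rewrite phiE dot_suml; apply: eq_bigr => i _.
rewrite dotZl dotC; have /rowP/(_ i) := zE; rewrite !mxE => <-.
by rewrite field_conjK.
Qed.

Section Adjoint.
Context (H : lmodType F) (dH : {dot H for field_conj R k}).

Lemma adjointP (f : {linear E -> H}) x y :
  dH (f x) y = dE x (adjoint dE dH f y).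
Proof.
rewrite /adjoint; case: xgetP => [z ->//|].
have [|z zE] := @riesz (fun x => dH (f x) y); last by move/(_ z).
by move=> a u v; rewrite linearP dotDl dotZl.
Qed.

Lemma adjoint_linear (f : {linear E -> H}) : linear (adjoint dE dH f).
Proof.
move=> a u v; apply: dot_ext => z.
by rewrite -adjointP !dotDr !dotZr !adjointP.
Qed.

Lemma gramE (f : {linear E -> H}) x : gram dE dH f x = adjoint dE dH f (f x).
Proof.
have lf : linear (adjoint dE dH f \o f).
  by move=> a u v; rewrite /= !linearP adjoint_linear.
by rewrite /gram; have := lfunE (linear_of lf) x.
Qed.

Lemma gramP (f : {linear E -> H}) x y : dE x (gram dE dH f y) = dH (f x) (f y).
Proof. by rewrite gramE adjointP. Qed.

End Adjoint.

Lemma adjE (A : 'End(E)) x : adj dE A x = adjoint dE dE A x.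
Proof. by rewrite /adj; have := lfunE (linear_of (adjoint_linear dE A)) x. Qed.

Lemma adjP (A : 'End(E)) x y : dE (A x) y = dE x (adj dE A y).
Proof. by rewrite adjE adjointP. Qed.

Lemma adjPC (A : 'End(E)) x y : dE x (A y) = dE (adj dE A x) y.
Proof. by rewrite dotC adjP -dotC. Qed.
End FinDim.

(** * Spectral theorem, pseudo-inverse and square root *)

(** A complex root a + i b of p gives the factor X - a if b = 0. Otherwise
(X - a)^2 + b^2 vanishes at the root, and so does the remainder of p by it,
which is real of degree at most 1 and hence zero. *)
Lemma real_poly_factor (R : realType) (p : {poly R}) : (1 < size p)%N ->
  (exists q a, p = q * ('X - a%:P)) \/
  (exists q a b, b != 0 /\ p = q * (('X - a%:P) ^+ 2 + (b ^+ 2)%:P)).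
Proof.
move=> p1; pose toC := map_poly (real_complex R).
have [|z] := closed_rootP (toC p) _.
  by rewrite size_map_poly; apply: contraTneq p1 => ->.
move=> pz; have zE : z = ((complex.Re z)%:C%C + (complex.Im z)%:C%C * 'i%C).
  by rewrite {1}[z]complexE [in X in _ + X]mulrC.
have [b0|b0] := eqVneq (complex.Im z) 0.
  left; have /factor_theorem[q ->] : root p (complex.Re z);
    last by exists q, (complex.Re z).
  by move: pz; rewrite zE b0 rmorph0 mul0r addr0 fmorph_root.
right; set a := complex.Re z in zE; set b := complex.Im z in b0 zE.
pose s := ('X - a%:P) ^+ 2 + (b ^+ 2)%:P.
have size_s : size s = 3%N.
  rewrite /s size_polyDl size_exp_XsubC//.
  by rewrite (leq_ltn_trans (size_polyC_leq1 _)).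
have s0 : s != 0 by rewrite -size_poly_eq0 size_s.
have sz : (toC s).[z] = 0.
  rewrite /toC rmorphD rmorphXn rmorphB /= map_polyX !map_polyC/= !hornerE.
  by rewrite {1}zE addrAC subrr add0r exprMn sqr_i mulrN1 rmorphXn addNr.
exists (p %/ s), a, b; split=> //; rewrite -/s.
suff r0 : p %% s = 0 by rewrite {1}(divp_eq p s) r0 addr0.
have size_r : (size (p %% s)%R <= 2)%N by rewrite -ltnS -size_s ltn_modp.
have : (toC (p %% s)).[z] = 0.
  have /rootP := pz; rewrite {1}(divp_eq p s) /toC rmorphD rmorphM /= !hornerE.
  by rewrite sz mulr0 add0r.
rewrite (@horner_coef_wide _ 2) ?size_map_poly// !big_ord_recl big_ord0 /=.
rewrite !coef_map /= addr0 expr0 mulr1 expr1 => rz.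
have r1 : (p %% s)`_1 = 0.
  move/(congr1 (@complex.Im R)) : rz.
  rewrite zE /= !(mul0r, mulr0, add0r, addr0, mulr1, subr0).
  by move=> /eqP; rewrite mulf_eq0 (negbTE b0) orbF => /eqP.
have r0 : (p %% s)`_0 = 0.
  by move: rz; rewrite r1 rmorph0 mul0r addr0 => -[].
apply/polyP => -[|[|i]]; rewrite ?r0 ?r1 coef0//.
by rewrite nth_default// (leq_trans size_r).
Qed.

Section Spectral.
Context (R : realType) (k : field_kind).
Local Notation F := (base_field R k).

Lemma poly_factor (p : {poly F}) : (1 < size p)%N ->
  (exists q a, p = q * ('X - a%:P)) \/
  (exists q (a b : R), b != 0 /\
     p = q * (('X - (rincl a)%:P) ^+ 2 + (rincl (b ^+ 2))%:P)).
Proof.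
rewrite /rincl; move: p; case: k => p p1; first exact: real_poly_factor.
left; have [|z] := closed_rootP p _; first by apply: contraTneq p1 => ->.
by case/factor_theorem => q ->; exists q, z.
Qed.

Context (E : vectType F) (dE : {dot E for field_conj R k}).
Implicit Types (A : 'End(E)) (p q : {poly F}) (w : E).

(** The vector p(A) w; p(A) itself is avoided since 'End(E) has no ring structure
for an E of arbitrary dimension. *)
Definition polyact A p w : E := \sum_(i < size p) p`_i *: iter i A w.

Lemma polyact_wide A n p w : (size p <= n)%N ->
  polyact A p w = \sum_(i < n) p`_i *: iter i A w.
Proof.
move=> pn; rewrite /polyact -!(big_mkord xpredT (fun i => p`_i *: iter i A w)).
rewrite [in RHS](big_cat_nat (leq0n _) pn)//= [X in _ = _ + X]big_nat_cond.
rewrite [X in _ = _ + X]big1 ?addr0// => i /andP[/andP[pi _] _].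
by rewrite nth_default// scale0r.
Qed.

Lemma polyactD A p q w : polyact A (p + q) w = polyact A p w + polyact A q w.
Proof.
rewrite (polyact_wide A w (size_polyD p q)).
rewrite (polyact_wide A w (leq_maxl (size p) (size q))).
rewrite (polyact_wide A w (leq_maxr (size p) (size q))) -big_split /=.
by apply: eq_bigr => i _; rewrite coefD scalerDl.
Qed.

Lemma polyactC A c w : polyact A c%:P w = c *: w.
Proof. by rewrite (polyact_wide A w (size_polyC_leq1 c)) big_ord1 coefC. Qed.

Lemma polyactMX A p w : polyact A (p * 'X) w = polyact A p (A w).
Proof.
rewrite (@polyact_wide A (size p).+1).
  rewrite big_ord_recl coefMX /= scale0r add0r; apply: eq_bigr => i _.
  by rewrite coefMX /= -iterSr.
by have [->|p0] := eqVneq p 0; rewrite ?mul0r ?size_poly0// size_mulX.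
Qed.

Lemma polyactZ A c p w : polyact A (c *: p) w = polyact A p (c *: w).
Proof.
rewrite (polyact_wide A w (size_scale_leq c p)); apply: eq_bigr => i _.
rewrite coefZ mulrC -scalerA; congr (_ *: _).
by elim: (i : nat) => //= n <-; rewrite linearZ.
Qed.

Lemma polyactDr A p v w :
  polyact A p (v + w) = polyact A p v + polyact A p w.
Proof.
rewrite /polyact -big_split; apply: eq_bigr => i _ /=.
rewrite -scalerDr; congr (_ *: _).
by elim: (i : nat) => //= n ->; rewrite linearD.
Qed.

Lemma polyactM A p q w : polyact A (p * q) w = polyact A p (polyact A q w).
Proof.
elim/poly_ind: q w => [|q c IH] w.
  rewrite mulr0 {1 3}/polyact size_poly0 !big_ord0 /polyact big1// => i _.
  suff -> : iter i A 0 = 0 by rewrite scaler0.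
  by elim: (i : nat) => //= n ->; rewrite linear0.
rewrite mulrDr mulrA !polyactD !polyactMX IH polyactC polyactDr; congr (_ + _).
by rewrite mulrC mul_polyC polyactZ.
Qed.

Lemma polyactXsub A c w : polyact A ('X - c%:P) w = A w - c *: w.
Proof.
rewrite -polyCN polyactD polyactC scaleNr; congr (_ - _).
by rewrite -['X]mul1r polyactMX -[1]/(1%:P) polyactC scale1r.
Qed.

(** The vectors w, A w, ..., A^n w with n = dim E are linearly dependent. *)
Lemma annihilator A w : exists2 p, p != 0 & polyact A p w = 0.
Proof.
pose n := (\dim {:E}).+1.
have lin : linear (fun c : 'rV[F]_n => \sum_i c 0 i *: iter i A w).
  move=> a u v; rewrite scaler_sumr -big_split; apply: eq_bigr => i _ /=.
  by rewrite !mxE scalerDl scalerA.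
pose f := linfun (linear_of lin).
have : lker f != 0%VS.
  apply/negP => /eqP ker0; have := @limg_dim_eq _ _ _ f fullv.
  rewrite ker0 capv0 => /(_ erefl) dimE; have := dimvS (subvf (limg f)).
  by rewrite dimE [X in (X <= _)%N]dimvf /dim /= mul1n ltnn.
rewrite -vpick0 => c0; have := memv_pick (lker f); rewrite memv_ker.
set c := vpick _ in c0 *; rewrite lfunE /= => /eqP cw.
exists (rVpoly c).
  by apply: contra c0 => /eqP c0; rewrite -[c]rVpolyK c0 linear0.
rewrite (polyact_wide A w (size_poly _ _)) -[RHS]cw; apply: eq_bigr => i _.
by rewrite coef_rVpoly_ord.
Qed.

(** Working with polynomials that annihilate a vector of W keeps the argument
inside W without restricting A to it. The proof is by induction on the degree of
such a p: write p = q r with r from [poly_factor]. If r(A) w <> 0, then q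
annihilates this vector of W. Otherwise w is an eigenvector when r = X - a, and
r = (X - a)^2 + b^2 is impossible, as then <r(A) w, w> = |(A - a) w|^2 + b^2 |w|^2
is positive. *)
Lemma selfadjoint_eigenvector A (W : {vspace E}) :
  selfadjoint dE A -> (forall w, w \in W -> A w \in W) ->
  forall w, w \in W -> w != 0 ->
  exists v (l : R), [/\ v \in W, v != 0 & A v = rincl l *: v].
Proof.
move=> sA WA w; have [p] := annihilator A w.
have Wsub c x y : x \in W -> y \in W -> c *: x + y \in W.
  by move=> xW yW; rewrite memvD ?memvZ.
have [n] := ubnP (size p); elim: n => // n IH in p w *.
rewrite ltnS => pn p0 pw wW w0.
have p1 : (1 < size p)%N.
  rewrite ltnNge; apply/negP => /size1_polyC pE; move: pw; rewrite pE polyactC.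
  move/eqP; rewrite scaler_eq0 (negbTE w0) orbF => /eqP p00.
  by move: p0; rewrite pE p00 eqxx.
case: (poly_factor p1) => [[q [a pE]]|[q [a [b [b0 pE]]]]].
  have [v0|v0] := eqVneq (A w - a *: w) 0.
    have Aw : A w = a *: w by apply/eqP; rewrite -subr_eq0 v0.
    have : field_conj R k a = a.
      have := sA w w; rewrite Aw dotZl dotZr => /eqP.
      rewrite -subr_eq0 -mulrBl mulf_eq0 => /orP[|/eqP/dot_eq0/eqP].
        by rewrite subr_eq0 => /eqP.
      by rewrite (negbTE w0).
    by move=> /field_conj_id aE; exists w, (field_re a); split=> //; rewrite -aE.
  apply: (IH q (A w - a *: w)) => //.
  - move: pn; rewrite pE size_Mmonic ?monicXsubC ?size_XsubC//; last first.
      by apply: contraTneq p1 => q0; rewrite pE q0 mul0r size_poly0.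
    by rewrite addn2.
  - by apply: contraNneq p0 => q0; rewrite pE q0 mul0r.
  - by rewrite -polyactXsub -polyactM -pE.
  - by rewrite addrC -scaleNr; apply: Wsub => //; apply: WA.
set v := polyact A (('X - (rincl a)%:P) ^+ 2 + (rincl (b ^+ 2))%:P) w.
pose u := A w - rincl a *: w.
have vE : v = A u - rincl a *: u + rincl (b ^+ 2) *: w.
  by rewrite /v polyactD expr2 polyactM !polyactXsub polyactC.
have uW : u \in W by rewrite /u addrC -scaleNr; apply: Wsub => //; apply: WA.
have q0 : q != 0 by apply: contraNneq p0 => q0; rewrite pE q0 mul0r.
have size_s :
    size (('X - (rincl a)%:P) ^+ 2 + (rincl (b ^+ 2))%:P : {poly F}) = 3%N.
  rewrite size_polyDl size_exp_XsubC//.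
  by rewrite (leq_ltn_trans (size_polyC_leq1 _)).
apply: (IH q v) => //.
- move: pn; rewrite pE size_mul// ?size_s -?size_poly_eq0 ?size_s//.
  by rewrite addn3 /= => /ltnW.
- by rewrite -polyactM -pE.
- rewrite vE addrC; apply: (Wsub _ _ _ wW).
  by rewrite addrC -scaleNr; apply: Wsub => //; apply: WA.
apply: contraTneq (dot_gt0 dE w0) => v0; have : dE v w = 0 by rewrite v0 dot0l.
rewrite vE dotDl dotBl dotZl sA -[rincl a]field_conj_rincl -dotZr -dotBr -/u.
rewrite dotZl.
move=> /eqP; rewrite paddr_eq0 ?dot_ge0//; last first.
  by rewrite mulr_ge0 ?dot_ge0// -(rincl0 R k) rincl_le sqr_ge0.
rewrite mulf_eq0 rincl_eq0 sqrf_eq0 (negbTE b0) /= => /andP[_ /eqP ->].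
by rewrite ltxx.
Qed.

(** Indexing by nat with a bound, rather than by ordinals, makes it easy to
append a vector to a family. *)
Definition orthonormal_family n (e : nat -> E) : Prop :=
  forall i j, (i < n)%N -> (j < n)%N -> dE (e i) (e j) = (i == j)%:R.

Lemma dot_sum_orthonormal n e (c : 'I_n -> F) (j : 'I_n) :
  orthonormal_family n e ->
  dE (\sum_i c i *: e i) (e j) = c j.
Proof.
move=> on; rewrite dot_suml (bigD1 j)//= dotZl on// eqxx mulr1 big1 ?addr0// => i ij.
by rewrite dotZl on// (_ : (i == j :> nat) = false) ?mulr0//; apply/negbTE.
Qed.

Lemma dim_orthonormal n e : orthonormal_family n e ->
  (\dim (lker (dot_rowf dE n e)) + n = \dim {:E})%N.
Proof.
move=> on; rewrite -[RHS](limg_ker_dim (dot_rowf dE n e)) capfv; congr (_ + _)%N.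
suff -> : limg (dot_rowf dE n e) = fullv by rewrite dimvf /dim/= mul1n.
apply/eqP; rewrite eqEsubv subvf; apply/subvP => c _; apply/memv_imgP.
exists (\sum_(i < n) c 0 i *: e i); rewrite ?memvf// dot_rowfE.
by apply/rowP => j; rewrite mxE dot_sum_orthonormal.
Qed.

(** As long as the eigenvectors found so far do not span E, their orthogonal
complement is nonzero and A-invariant, so it contains a further eigenvector;
m counts the missing ones. *)
Lemma spectral_theorem A : selfadjoint dE A -> exists n e (l : nat -> R),
  [/\ orthonormal_family n e, forall x, x = \sum_(i < n) dE x (e i) *: e i
   & forall i, (i < n)%N -> A (e i) = rincl (l i) *: e i].
Proof.
move=> sA.
suff : forall m n e (l : nat -> R), orthonormal_family n e ->
    (forall i, (i < n)%N -> A (e i) = rincl (l i) *: e i) ->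
    (m + n = (\dim {:E}))%N ->
  exists n e (l : nat -> R),
  [/\ orthonormal_family n e, forall x, x = \sum_(i < n) dE x (e i) *: e i
   & forall i, (i < n)%N -> A (e i) = rincl (l i) *: e i].
  by move/(_ (\dim {:E}) 0%N (fun=> 0) (fun=> 0)); apply; rewrite ?addn0.
elim=> [|m IH] n e l on Ae; rewrite -(dim_orthonormal on) => /addIn dimE.
  exists n, e, l; split=> // x; apply/eqP; rewrite -subr_eq0 -memv0.
  have /eqP <- : lker (dot_rowf dE n e) == 0%VS by rewrite -dimv_eq0 -dimE.
  rewrite memv_ker dot_rowfE; apply/eqP/rowP => j; rewrite !mxE dotBl.
  by rewrite dot_sum_orthonormal// subrr.
have inkerP x : x \in lker (dot_rowf dE n e) -> forall i, (i < n)%N -> dE x (e i) = 0.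
  rewrite memv_ker dot_rowfE => /eqP/rowP xe i ilt.
  by have := xe (Ordinal ilt); rewrite !mxE.
have vp0 : vpick (lker (dot_rowf dE n e)) != 0.
  by rewrite vpick0 -dimv_eq0 -dimE.
have Astable w :
    w \in lker (dot_rowf dE n e) -> A w \in lker (dot_rowf dE n e).
  move=> wker; rewrite memv_ker dot_rowfE; apply/eqP/rowP => j.
  by rewrite !mxE sA Ae// dotZr inkerP// mulr0.
have [v [c [/inkerP vker v0 Av]]] :=
  selfadjoint_eigenvector sA Astable (memv_pick _) vp0.
have nv0 : dotnorm dE v != 0.
  apply: contra v0 => /eqP nv; apply/eqP/(@dot_eq0 _ _ _ dE).
  by rewrite dot_rincl -dotnorm_sqr nv expr0n rincl0.
pose v' := rincl (dotnorm dE v)^-1 *: v.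
have v'e i : (i < n)%N -> dE v' (e i) = 0 by move=> ilt; rewrite dotZl vker// mulr0.
have v'v' : dE v' v' = 1.
  rewrite dotZl dotZr field_conj_rincl dot_rincl -dotnorm_sqr -!rinclM.
  by rewrite expr2 (mulKf nv0) mulVf// rincl1.
pose e' i := if i == n then v' else e i.
pose l' i := if i == n then c else l i.
apply: (IH n.+1 e' l').
- have casesS i : (i < n.+1)%N -> i = n \/ (i < n)%N.
    by rewrite ltnS leq_eqVlt => /orP[/eqP|]; [left|right].
  move=> i j /casesS ic /casesS jc; rewrite /e'.
  case: ic jc => [->|ilt] [->|jlt]; rewrite ?eqxx//.
  + by rewrite (gtn_eqF jlt) (ltn_eqF jlt) v'e.
  + by rewrite (ltn_eqF ilt) dotC v'e// field_conj0.
  + by rewrite (ltn_eqF ilt) (ltn_eqF jlt) on.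
- move=> i; rewrite ltnS leq_eqVlt /e' /l' => /orP[/eqP->|ilt].
    by rewrite eqxx linearZ/= Av scalerA mulrC -scalerA.
  by rewrite (ltn_eqF ilt) Ae.
- by rewrite addnS -addSn dimE dim_orthonormal.
Qed.

(** Functional calculus in an eigenbasis: the pseudo-inverse is f(A) for
f(t) = 1/t, and its root is f(A) for f(t) = sqrt(1/t). Since 0^-1 = 0, these f
also take the right value on the kernel. *)
Lemma psd_pinv_sqrt A : psd dE A -> exists X S : 'End(E),
  [/\ penrose dE A X, psd dE X, psd dE S & (S \o S)%VF = X].
Proof.
case=> sA A0; have [n [e [l [on eE Ae]]]] := spectral_theorem sA.
have l0 i : (i < n)%N -> 0 <= l i.
  move=> ilt; have := A0 (e i); rewrite Ae// dotZl on// eqxx mulr1.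
  by rewrite -(rincl0 R k) rincl_le.
have lin (f : R -> R) :
    linear (fun x => \sum_(i < n) (rincl (f (l i)) * dE x (e i)) *: e i).
  move=> a x y; rewrite scaler_sumr -big_split; apply: eq_bigr => i _ /=.
  by rewrite dotDl dotZl mulrDr scalerDl scalerA mulrCA.
pose Phi f : 'End(E) := linfun (linear_of (lin f)).
have PhiE f x : Phi f x = \sum_(i < n) (rincl (f (l i)) * dE x (e i)) *: e i.
  by rewrite lfunE.
have dotE x y :
    dE x y = \sum_(i < n) dE x (e i) * field_conj R k (dE y (e i)).
  by rewrite {1}(eE x) dot_suml; apply: eq_bigr => i _; rewrite dotZl -dotC.
have Phi_dot f x (i : 'I_n) : dE (Phi f x) (e i) = rincl (f (l i)) * dE x (e i).
  by rewrite PhiE (dot_sum_orthonormal _ _ on).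
have Phi_self f : selfadjoint dE (Phi f).
  move=> x y; rewrite dotE [RHS]dotE; apply: eq_bigr => i _; rewrite !Phi_dot.
  by rewrite field_conjM field_conj_rincl mulrCA mulrA.
have Phi_comp f g : (Phi f \o Phi g)%VF = Phi (fun x => f x * g x).
  apply/lfunP => x; rewrite comp_lfunE PhiE [RHS]PhiE; apply: eq_bigr => i _.
  by rewrite Phi_dot mulrA -rinclM.
have Phi_psd f : (forall i, (i < n)%N -> 0 <= f (l i)) -> psd dE (Phi f).
  move=> f0; split=> // x; rewrite dotE sumr_ge0// => i _.
  by rewrite Phi_dot -mulrA mulr_conj mulr_ge0 ?exprn_ge0// -(rincl0 R k) rincl_le f0.
have eqPhi f g : (forall i, (i < n)%N -> f (l i) = g (l i)) -> Phi f = Phi g.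
  by move=> fg; apply/lfunP => x; rewrite !PhiE; apply: eq_bigr => i _; rewrite fg.
have AE : A = Phi id.
  apply/lfunP => x; rewrite {1}(eE x) linear_sum PhiE; apply: eq_bigr => i _.
  by rewrite linearZ/= Ae// scalerA mulrC.
exists (Phi (fun x => x^-1)), (Phi (fun x => Num.sqrt x^-1)); split.
- split; rewrite AE ?Phi_comp//; apply: eqPhi => i _ /=.
    by have [->|li0] := eqVneq (l i) 0; rewrite ?mulr0// mulfV// mul1r.
  by have [->|li0] := eqVneq (l i) 0; rewrite ?invr0 ?mulr0// mulVf// mul1r.
- by apply: Phi_psd => i ilt; rewrite invr_ge0 l0.
- by apply: Phi_psd => i ilt; rewrite sqrtr_ge0.
- rewrite Phi_comp; apply: eqPhi => i ilt /=.
  by rewrite -expr2 sqr_sqrtr// invr_ge0 l0.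
Qed.

(** Both A X and A Y are the orthogonal projection onto the range of A, and both
X A and Y A the orthogonal projection along its kernel, so that
X = X A X = Y A Y = Y. *)
Lemma penrose_uniq A X Y : penrose dE A X -> penrose dE A Y -> X = Y.
Proof.
move=> [+ + sAX sXA] [+ + sAY sYA].
have at_point (B C D T : 'End(E)) :
    (B \o C \o D)%VF = T -> forall x, B (C (D x)) = T x.
  by move=> <- x; rewrite !comp_lfunE.
have self_at (B C : 'End(E)) : selfadjoint dE (B \o C)%VF ->
    forall x y, dE (B (C x)) y = dE x (B (C y)).
  by move=> sBC x y; have := sBC x y; rewrite !comp_lfunE.
move: sAX sXA sAY sYA => /self_at sAX /self_at sXA /self_at sAY /self_at sYA.
move=> /at_point a1 /at_point a2 /at_point b1 /at_point b2.
have AXY x : A (X x) = A (Y x).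
  by apply: (dot_ext (dE := dE)) => z; rewrite -[in LHS]b1 -sAY -sAX a1 sAY.
have XYA x : X (A x) = Y (A x).
  apply: (dot_ext (dE := dE)) => z.
  by rewrite -sXA -[in LHS]b1 sXA -sYA sYA a1.
by apply/lfunP => x; rewrite -a2 -b2 AXY XYA.
Qed.

Lemma pinvP A : psd dE A -> penrose dE A (Defs.pinv dE A) /\ psd dE (Defs.pinv dE A).
Proof.
move=> pA; have [X [S [AX pX _ _]]] := psd_pinv_sqrt pA.
have : penrose dE A (Defs.pinv dE A).
  by rewrite /Defs.pinv; case: xgetP => [Y _ //|/(_ X)].
by move=> AY; split=> //; rewrite (penrose_uniq AY AX).
Qed.

Section PseudoInverse.
Context (A : 'End(E)) (pA : psd dE A).
Local Notation X := (Defs.pinv dE A).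
Local Notation S := (pinv_half dE A).

Lemma pinvAXA x : A (X (A x)) = A x.
Proof. by have [[/lfunP/(_ x)+ _ _ _] _] := pinvP pA; rewrite !comp_lfunE. Qed.

Lemma pinvXAX x : X (A (X x)) = X x.
Proof. by have [[_ /lfunP/(_ x)+ _ _] _] := pinvP pA; rewrite !comp_lfunE. Qed.

Lemma pinvAX_self x y : dE (A (X x)) y = dE x (A (X y)).
Proof. by have [[_ _ /(_ x y)+ _] _] := pinvP pA; rewrite !comp_lfunE. Qed.

Lemma pinvXA_self x y : dE (X (A x)) y = dE x (X (A y)).
Proof. by have [[_ _ _ /(_ x y)+] _] := pinvP pA; rewrite !comp_lfunE. Qed.

Lemma pinv_halfP : psd dE S /\ (S \o S)%VF = X.
Proof.
have [X' [S' [AX' pX' pS' SS']]] := psd_pinv_sqrt pA.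
rewrite /pinv_half /psd_sqrt; case: xgetP => [Y _ //|/(_ S')[]]; split=> //.
by rewrite SS' (penrose_uniq AX' (pinvP pA).1).
Qed.

Lemma pinv_half_self : selfadjoint dE S.
Proof. by have [[]] := pinv_halfP. Qed.

Lemma pinv_halfK x : S (S x) = X x.
Proof. by have [_ /lfunP/(_ x)] := pinv_halfP; rewrite comp_lfunE. Qed.

(** The endomorphism S A S is selfadjoint and idempotent, that is, an orthogonal
projection. *)
Lemma pinv_half_contraction x : dE (A (S x)) (S x) <= dE x x.
Proof.
have PP y : S (A (S (S (A (S y))))) = S (A (S y)) by rewrite pinv_halfK pinvAXA.
have sS := pinv_half_self; have [sA _] := pA.
have Pself y z : dE (S (A (S y))) z = dE y (S (A (S z))) by rewrite sS sA sS.
have -> : dE (A (S x)) (S x) = dE (S (A (S x))) (S (A (S x))).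
  by rewrite -sS -[in LHS]PP Pself.
set y := S (A (S x)); have -> : x = y + (x - y) by rewrite addrC subrK.
rewrite dot_pythagoras ?lerDl ?dot_ge0//.
by rewrite dotBr {1 3}/y !Pself -/y /y PP subrr.
Qed.

End PseudoInverse.
End Spectral.

(** * Norms of linear decoders *)

Section Decoders.
Context (R : realType) (k : field_kind).
Local Notation F := (base_field R k).

Lemma dotnorm_mono (U V : lmodType F) (dU : {dot U for field_conj R k})
    (dV : {dot V for field_conj R k}) x y :
  (dotnorm dU x <= dotnorm dV y) = (dU x x <= dV y y).
Proof.
rewrite dotnorm_le ?dotnorm_ge0// dotnorm_sqr -(@rincl_le R k).
by rewrite -!dot_rincl.
Qed.

Lemma opnorm_ub (U V : lmodType F) (nU : U -> R) (nV : V -> R) (f : U -> V) x :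
  nU x <= 1 -> ((nV (f x))%:E <= opnorm nU nV f)%E.
Proof. by move=> x1; apply: ereal_sup_ubound; exists x. Qed.

Lemma opnorm_le (U V : lmodType F) (nU : U -> R) (nV : V -> R) (f : U -> V)
    (c : \bar R) :
  (forall x, nU x <= 1 -> ((nV (f x))%:E <= c)%E) -> (opnorm nU nV f <= c)%E.
Proof. by move=> h; apply: ge_ereal_sup => _ [x x1 <-]; exact: h. Qed.

Section Bounded.
Context (H Z : normedModType F).

Local Notation opnormHZ := (opnorm (@rnorm R k H) (@rnorm R k Z)).

Lemma opnorm_ge0 (D : {linear H -> Z}) : (0%:E <= opnormHZ D)%E.
Proof.
have := @opnorm_ub _ _ (@rnorm R k H) (@rnorm R k Z) D 0.
by rewrite linear0 !rnorm0; apply.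
Qed.

Lemma opnorm_bound (D : {linear H -> Z}) (c : R) x :
  (opnormHZ D <= c%:E)%E -> rnorm (D x) <= c * rnorm x.
Proof.
move=> Dc; have [x0|x0] := eqVneq (rnorm x) 0.
  by rewrite (rnorm_eq0 x0) linear0 !rnorm0 mulr0.
have xpos : 0 < rnorm x by rewrite lt_neqAle eq_sym x0 rnorm_ge0.
have := @opnorm_ub _ _ (@rnorm R k H) (@rnorm R k Z) D
  (rincl (rnorm x)^-1 *: x).
have xi : 0 <= (rnorm x)^-1 by rewrite invr_ge0 ltW.
rewrite linearZ/= !rnormZ// mulVf// lexx => /(_ erefl) /le_trans/(_ Dc).
by rewrite lee_fin mulrC ler_pdivrMr.
Qed.

Lemma opnorm_leP (D : {linear H -> Z}) (c : R) : 0 <= c ->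
  (forall x, rnorm (D x) <= c * rnorm x) -> (opnormHZ D <= c%:E)%E.
Proof.
move=> c0 Dc; apply: opnorm_le => x x1; rewrite lee_fin (le_trans (Dc x))//.
by rewrite -[leRHS]mulr1 ler_wpM2l.
Qed.

Lemma bounded_opP (D : {linear H -> Z}) : bounded_op D ->
  exists c : R, [/\ opnormHZ D = c%:E, 0 <= c
   & forall x, rnorm (D x) <= c * rnorm x].
Proof.
rewrite /bounded_op; have := opnorm_ge0 D; have := @opnorm_bound D.
case: (opnorm _ _ D) => [c Dc|//|//]; rewrite lee_fin => c0 _.
by exists c; split=> // x; apply: Dc.
Qed.

End Bounded.

Section FiniteDim.
Context (E : vectType F) (dE : {dot E for field_conj R k}).
Context (H : normedModType F) (dH : {dot H for field_conj R k}).
Context (hH : hilbert_norm dH).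
Context (Z : normedModType F).

Lemma opnorm_finite (g : {linear E -> Z}) :
  (opnorm (dotnorm dE) (@rnorm R k Z) g < +oo)%E.
Proof.
(* any orthonormal basis does; here an eigenbasis of 0 *)
have s0 : selfadjoint dE 0 by move=> x y; rewrite !lfunE /= dot0l dot0r.
have [n [e [_ [on eE _]]]] := spectral_theorem s0.
apply: (@le_lt_trans _ _ (\sum_(i < n) rnorm (g (e i)))%:E); last by rewrite ltry.
apply: opnorm_le => x x1; rewrite lee_fin {1}(eE x) linear_sum.
apply: (@le_trans _ _ (\sum_(i < n) rnorm (g (dE x (e i) *: e i)))).
  elim/big_ind2: _ => [|x1' x2 y1 y2 h1 h2|//]; first by rewrite rnorm0.
  by rewrite (le_trans (rnorm_triangle _ _))// lerD.
apply: ler_sum => i _; rewrite -(@rincl_le R k) -!rnormE linearZ normrZ.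
rewrite -[leRHS]mul1r ler_wpM2r// -(@ler_pXn2r _ 2) ?nnegrE// expr1n.
have {}x1 : dE x x <= 1.
  by move: x1; rewrite dotnorm_le// expr1n -(@rincl_le R k) -dot_rincl rincl1.
apply: le_trans x1; rewrite {3}(eE x) dot_sumr (bigD1 i)//=.
rewrite dotZr mulrC mulr_conj lerDl sumr_ge0// => j _.
by rewrite dotZr mulrC mulr_conj exprn_ge0.
Qed.

Context (C : {linear E -> H}) (L : {linear E -> Z}).

(** This is the common source of the formulas for kappa. The decoder is
L T T* C*, of norm at most that of L T since T* C* is a contraction, and the
lower bound is L T = D C T for each decoder D. *)
Lemma least_decoder (T : 'End(E)) :
  (forall x, dH (C (T x)) (C (T x)) <= dE x x) ->
  (forall x, L (T (adj dE T (gram dE dH C x))) = L x) ->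
  is_least (decoder_norms C L)
    (opnorm (dotnorm dE) (@rnorm R k Z) (fun x => L (T x))).
Proof.
move=> CT LT.
have lower (D : {linear H -> Z}) : (forall x, D (C x) = L x) ->
    (opnorm (dotnorm dE) (@rnorm R k Z) (fun x => L (T x))
      <= opnorm (@rnorm R k H) (@rnorm R k Z) D)%E.
  move=> DC; apply: opnorm_le => x x1; rewrite -DC; apply: opnorm_ub.
  by rewrite (hilbert_rnorm hH) (le_trans _ x1)// dotnorm_mono.
split; last by move=> _ [D [_ DC ->]]; exact: lower.
(* With u = T* C* y, 0 <= |y - C T u|^2 = |y|^2 - 2 |u|^2 + |C T u|^2, where
   the cross terms are <y, C T u> = |u|^2, and |C T u| <= |u|. *)
have contr y : dE (adj dE T (adjoint dE dH C y))
                  (adj dE T (adjoint dE dH C y)) <= dH y y.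
  set u := adj dE T _; have uu : dE u u = dH (C (T u)) y.
    by rewrite [RHS](adjointP dE) [RHS]adjP.
  have := dot_ge0 dH (y - C (T u)).
  rewrite dotBl !dotBr (dotC dH y (C _)) -uu [X in field_conj R k X]dot_rincl.
  rewrite field_conj_rincl -dot_rincl subr_ge0 => h.
  by rewrite -subr_ge0; apply: le_trans h; rewrite subr_ge0 CT.
have lD : linear (fun y => L (T (adj dE T (adjoint dE dH C y)))).
  by move=> a u v; rewrite (adjoint_linear dE dH C) !linearP.
pose D := linear_of lD; exists D.
have DC x : D (C x) = L x by rewrite /= -gramE LT.
have Dle : (opnorm (@rnorm R k H) (@rnorm R k Z) D <=
    opnorm (dotnorm dE) (@rnorm R k Z) (fun x => L (T x)))%E.
  apply: opnorm_le => y y1; apply: opnorm_ub.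
  by apply: le_trans y1; rewrite (hilbert_rnorm hH) dotnorm_mono.
split=> //; last by apply/le_anti; rewrite Dle lower.
exact: le_lt_trans Dle (opnorm_finite (L \o T)).
Qed.

End FiniteDim.
End Decoders.

(** * Worst-case errors *)

Section Risk.
Context (R : realType) (k : field_kind).
Local Notation F := (base_field R k).
Context (E : lmodType F) (H Z : normedModType F).
Context (C : {linear E -> H}) (L : {linear E -> Z}).

Lemma worst_error_ub delta (Dec : H -> Z) x e : rnorm e <= delta ->
  ((rnorm (Dec (C x + e) - L x))%:E <= worst_error C L delta Dec)%E.
Proof. by move=> e1; apply: ereal_sup_ubound; exists (x, e). Qed.

(** The signals x and -x with the noises - C x and C x both give the data 0,
while their targets are at distance 2 |L x|. *)
Lemma worst_error_lower delta (Dec : H -> Z) x : rnorm (C x) <= delta ->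
  ((rnorm (L x))%:E <= worst_error C L delta Dec)%E.
Proof.
move=> Cx; have := @worst_error_ub delta Dec x (- C x).
have := @worst_error_ub delta Dec (- x) (C x).
rewrite rnormN !linearN addNr subrr => /(_ Cx) h1 /(_ Cx) h2.
case: (worst_error _ _ _ _) h1 h2 => [w||]; rewrite ?leey ?leeNy_eq//.
rewrite !lee_fin => h1 h2.
have : 2 * rnorm (L x) <= w + w.
  have <- : rnorm (L x + L x) = 2 * rnorm (L x).
    rewrite -mulr2n -scaler_nat (_ : 2%:R = rincl 2 :> F) ?rnormZ//.
    by rewrite -[2 in RHS]/(1 + 1)%R rinclD rincl1.
  have -> : L x + L x = (Dec 0 - - L x) + (L x - Dec 0).
    by rewrite opprK [Dec 0 + _]addrC addrACA subrr addr0.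
  by rewrite (le_trans (rnorm_triangle _ _))// lerD// rnormBC.
by rewrite -mulr2n -[w *+ 2]mulr_natl ler_pM2l.
Qed.

(** Apply [worst_error_lower] to the multiples of a vector of ker C outside
ker L. *)
Lemma worst_error_incompatible delta (Dec : H -> Z) :
  0 <= delta -> ~ ker_sub C L ->
  worst_error C L delta Dec = +oo%E.
Proof.
move=> d0; rewrite -existsNP => -[x /not_implyP[Cx /eqP Lx]].
have lb (n : nat) : ((n%:R * rnorm (L x))%:E <= worst_error C L delta Dec)%E.
  rewrite -rnormZ// -linearZ; apply: worst_error_lower.
  by rewrite linearZ/= Cx scaler0 rnorm0.
have Lx0 : 0 < rnorm (L x).
  by rewrite lt_neqAle rnorm_ge0 andbT eq_sym; apply: contra Lx => /eqP/rnorm_eq0 ->.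
case: (worst_error _ _ _ _) lb => [w||] lb //; last by have := lb 0%N.
have := lb (Num.truncn (w / rnorm (L x))).+1.
by rewrite lee_fin -ler_pdivlMr// leNgt truncnS_gt.
Qed.

Lemma worst_error_decoder delta c (D : {linear H -> Z}) : 0 <= c ->
  (forall x, D (C x) = L x) -> (forall y, rnorm (D y) <= c * rnorm y) ->
  (worst_error C L delta D <= (delta * c)%:E)%E.
Proof.
move=> c0 DC Dc; apply: ge_ereal_sup => _ [[x e] /= ed <-].
rewrite lee_fin linearD DC addrAC subrr add0r (le_trans (Dc e))//.
by rewrite mulrC ler_wpM2r.
Qed.

Lemma exactly_recoverableP : exactly_recoverable C L <-> ker_sub C L.
Proof.
split=> [[f fC] x Cx|CL]; first by rewrite -fC Cx -(linear0 C) fC linear0.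
exists (fun y => L (xget 0 [set x | C x = y])) => x.
case: xgetP => [z _ Cz|/(_ x)[]//].
apply/eqP; rewrite -subr_eq0 -linearB; apply/eqP/CL.
by rewrite linearB/= Cz subrr.
Qed.

End Risk.

(** * The constant kappa *)

Section Kappa.
Context (R : realType) (k : field_kind).
Local Notation F := (base_field R k).
Context (E : vectType F) (dE : {dot E for field_conj R k}).

Lemma adj_selfadjoint (A : 'End(E)) : selfadjoint dE A -> adj dE A = A.
Proof.
by move=> sA; apply/lfunP => x; apply: (dot_ext (dE := dE)) => z; rewrite -adjP sA.
Qed.

Section Gram.
Context (H : lmodType F) (dH : {dot H for field_conj R k}) (C : {linear E -> H}).

Lemma gram_psd : psd dE (gram dE dH C).
Proof.
split=> [x y|x]; last by rewrite dotC gramP -dotC dot_ge0.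
by rewrite gramP dotC gramP -dotC.
Qed.

Lemma gram_eq0 x : gram dE dH C x = 0 <-> C x = 0.
Proof.
split=> [Gx|Cx]; first by apply: (@dot_eq0 _ _ _ dH); rewrite -(gramP dE) Gx dot0r.
by apply: (dot_ext (dE := dE)) => z; rewrite gramP Cx !dot0r.
Qed.

(** The range of the selfadjoint Gram map G is the orthogonal complement of its
kernel, and the kernel of G is that of C. *)
Lemma gram_pinv w : (forall v, C v = 0 -> dE v w = 0) ->
  gram dE dH C (Defs.pinv dE (gram dE dH C) w) = w.
Proof.
have pG := gram_psd; set G := gram dE dH C in pG *; move=> w_perp.
pose v := w - G (Defs.pinv dE G w); apply/esym/eqP; rewrite -subr_eq0 -/v; apply/eqP.
have Gv : G v = 0.
  apply: (dot_ext (dE := dE)) => z; rewrite -pG.1 dotBr dot0r.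
  by rewrite -(pinvAX_self pG) pinvAXA// subrr.
apply: (@dot_eq0 _ _ _ dE); rewrite {2}/v dotBr -pG.1 Gv dot0l subr0.
exact/w_perp/gram_eq0.
Qed.
End Gram.

Context (H : normedModType F) (dH : {dot H for field_conj R k}).
Context (hH : hilbert_norm dH).
Context (Z : normedModType F).
Context (C : {linear E -> H}) (L : {linear E -> Z}).
Local Notation G := (gram dE dH C).

Lemma kappaE : ker_sub C L -> kappa dE dH C L =
  opnorm (dotnorm dE) (@rnorm R k Z) (fun x => L (pinv_half dE G x)).
Proof. by rewrite /kappa; case: asboolP. Qed.

Lemma kappa_pinfty : ~ ker_sub C L -> kappa dE dH C L = +oo%E.
Proof. by rewrite /kappa; case: asboolP. Qed.

Lemma gram_half_contraction x :
  dH (C (pinv_half dE G x)) (C (pinv_half dE G x)) <= dE x x.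
Proof.
rewrite -(gramP dE); apply: le_trans (pinv_half_contraction (gram_psd dH C) x).
by rewrite [leRHS](gram_psd dH C).1.
Qed.

(** [least_decoder] with the selfadjoint T = G^(dagger/2): T T* C* C = G^dagger G
differs from the identity by vectors of ker G = ker C. *)
Lemma kappa_least : ker_sub C L -> is_least (decoder_norms C L) (kappa dE dH C L).
Proof.
move=> CL; have pG := gram_psd dH C; rewrite kappaE//.
apply: (least_decoder hH gram_half_contraction) => x.
rewrite adj_selfadjoint; last exact: pinv_half_self.
rewrite pinv_halfK//; apply/esym/eqP; rewrite -subr_eq0 -linearB.
by apply/eqP/CL/(gram_eq0 dH); rewrite linearB/= pinvAXA// subrr.
Qed.

Lemma kappa_ge0 : (0 <= kappa dE dH C L)%E.
Proof.
have [CL|CL] := pselect (ker_sub C L); last by rewrite kappa_pinfty.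
by have [[D [_ _ ->]] _] := kappa_least CL; apply: opnorm_ge0.
Qed.

(** Apply [worst_error_lower] to the vectors delta G^(dagger/2) x with x in the
unit ball: C maps each of them into the ball of radius delta. *)
Lemma kappa_risk delta (Dec : H -> Z) : 0 < delta ->
  (delta%:E * kappa dE dH C L <= worst_error C L delta Dec)%E.
Proof.
move=> d0; have [CL|CL] := pselect (ker_sub C L); last first.
  by rewrite (worst_error_incompatible _ (ltW d0) CL) leey.
rewrite -lee_pdivlMl// kappaE//; apply: opnorm_le => x x1.
rewrite lee_pdivlMl// -EFinM -rnormZ ?(ltW d0)// -linearZ; apply: worst_error_lower.
rewrite linearZ/= rnormZ ?(ltW d0)// -[leRHS]mulr1 ler_wpM2l ?(ltW d0)//.
rewrite (hilbert_rnorm hH) (le_trans _ x1)// dotnorm_mono.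
exact: gram_half_contraction.
Qed.

Lemma optimal_error_kappa delta : 0 < delta ->
  optimal_error C L delta = (delta%:E * kappa dE dH C L)%E.
Proof.
move=> d0; apply/le_anti/andP; split; last first.
  by apply: le_ereal_inf_tmp => _ [Dec _ <-]; exact: kappa_risk.
have [CL|CL] := pselect (ker_sub C L); last first.
  by rewrite kappa_pinfty// gt0_muley// leey.
have [[D [/bounded_opP[c [-> c0 Dc]] DC ->]] _] := kappa_least CL.
rewrite -EFinM; apply: le_trans (worst_error_decoder _ c0 DC Dc).
by apply: ereal_inf_lbound; exists D.
Qed.

End Kappa.

(** * Orthogonal block projections *)

Section Blocks.
Context (R : realType) (k : field_kind).
Local Notation F := (base_field R k).
Context (E : vectType F) (dE : {dot E for field_conj R k}).
Context (N : nat) (V : nat -> {vspace E}) (hV : orthogonal_blocks dE N V).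
Local Notation b := (bproj N V).
Local Notation Q := (bproj_lt N V).
Local Notation others i := (\sum_(j < N.+1 | (j : nat) != i) V j)%VS.

Lemma block_cap_others i : (i <= N)%N -> (V i :&: others i = 0)%VS.
Proof.
move=> iN; apply/eqP; rewrite -subv0; apply/subvP => x.
rewrite memv_cap memv0 => /andP[xi /memv_sumP[v vV xE]].
apply/eqP/(@dot_eq0 _ _ _ dE); rewrite {2}xE dot_sumr big1// => j ji.
by apply: (hV.1 i j); rewrite ?leq_ord// 1?eq_sym// vV.
Qed.

Lemma bproj_mem i x : b i x \in V i.
Proof. exact: memv_pi. Qed.

Lemma bproj_id i x : (i <= N)%N -> x \in V i -> b i x = x.
Proof. by move=> iN; apply/daddv_pi_id/block_cap_others. Qed.

Lemma bproj_ortho i j x : (i <= N)%N -> (j <= N)%N -> i != j -> x \in V j -> b i x = 0.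
Proof.
move=> iN jN ij xj.
have xo : x \in others i.
  have jlt : (j < N.+1)%N by [].
  by apply: subvP xj; apply: (sumv_sup (Ordinal jlt)) => //=; rewrite eq_sym.
have := daddv_pi_add (block_cap_others iN) (subvP (addvSr _ _) _ xo).
rewrite (@daddv_pi_id _ _ (others i)) 1?capvC ?block_cap_others//.
by move=> /eqP; rewrite -subr_eq0 addrK => /eqP.
Qed.

Lemma bprojK i x : (i <= N)%N -> b i (b i x) = b i x.
Proof. by move=> iN; rewrite bproj_id// bproj_mem. Qed.

Lemma bproj_bproj i j x : (i <= N)%N -> (j <= N)%N -> i != j -> b i (b j x) = 0.
Proof. by move=> iN jN ij; apply: (bproj_ortho iN jN ij (bproj_mem _ _)). Qed.

Lemma bproj_sum x : \sum_(i < N.+1) b i x = x.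
Proof.
have : x \in (\sum_(i < N.+1) V i)%VS by rewrite hV.2 memvf.
case/memv_sumP => v vV ->; apply: eq_bigr => i _.
rewrite linear_sum (bigD1 i)//= bproj_id ?vV ?leq_ord// big1 ?addr0// => j ji.
by apply: bproj_ortho (vV j isT); rewrite ?leq_ord// eq_sym.
Qed.

Lemma bproj_self i : (i <= N)%N -> selfadjoint dE (b i).
Proof.
move=> iN x y; have ilt : (i < N.+1)%N by [].
have aux u v : dE (b i u) v = dE (b i u) (b i v).
  rewrite -{1}(bproj_sum v) dot_sumr (bigD1 (Ordinal ilt))//=.
  rewrite big1 ?addr0// => j ji.
  apply: (hV.1 i j); rewrite ?leq_ord ?bproj_mem//.
  by apply: contra ji => /eqP ij; apply/eqP/val_inj.
by rewrite aux dotC -aux -dotC.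
Qed.

Lemma bproj_ltE n x : Q n x = \sum_(i < n) b i x.
Proof. by rewrite /bproj_lt sum_lfunE. Qed.

Lemma bproj_ltS n x : Q n.+1 x = Q n x + b n x.
Proof. by rewrite !bproj_ltE big_ord_recr. Qed.

Lemma bproj_lt0 x : Q 0 x = 0.
Proof. by rewrite bproj_ltE big_ord0. Qed.

Lemma bproj_lt_full x : Q N.+1 x = x.
Proof. by rewrite bproj_ltE bproj_sum. Qed.

Lemma bproj_lt_self n : (n <= N.+1)%N -> selfadjoint dE (Q n).
Proof.
move=> nN x y; rewrite !bproj_ltE dot_suml dot_sumr; apply: eq_bigr => i _.
by apply: bproj_self; rewrite -ltnS (leq_trans (ltn_ord i)).
Qed.

Lemma bproj_bproj_lt i n x : (i < n)%N -> (n <= N.+1)%N -> b i (Q n x) = b i x.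
Proof.
move=> ilt nN; rewrite bproj_ltE linear_sum (bigD1 (Ordinal ilt))//=.
have iN : (i <= N)%N by rewrite -ltnS (leq_trans ilt).
rewrite bprojK// big1 ?addr0// => j ji; apply: bproj_bproj => //.
  by rewrite -ltnS (leq_trans (ltn_ord j)).
by apply: contra ji => /eqP ij; apply/eqP/val_inj.
Qed.

Lemma bproj_bproj_lt0 i n x : (n <= i)%N -> (i <= N)%N -> b i (Q n x) = 0.
Proof.
move=> ni iN; rewrite bproj_ltE linear_sum big1// => j _.
have ji := leq_trans (ltn_ord j) ni.
by apply: bproj_bproj; rewrite // ?(leq_trans (ltnW ji))// gtn_eqF.
Qed.

Lemma bproj_lt_bproj i n x : (i < n)%N -> (n <= N.+1)%N -> Q n (b i x) = b i x.
Proof.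
move=> ilt nN; apply: (dot_ext (dE := dE)) => z.
have iN : (i <= N)%N by rewrite -ltnS (leq_trans ilt).
by rewrite -bproj_lt_self// -!bproj_self// bproj_bproj_lt.
Qed.

Lemma bproj_lt_bproj0 i n x : (n <= i)%N -> (i <= N)%N -> Q n (b i x) = 0.
Proof.
move=> ni iN; apply: (dot_ext (dE := dE)) => z.
rewrite -bproj_lt_self ?(leq_trans ni (leqW iN))// -bproj_self//.
by rewrite bproj_bproj_lt0// dot0l dot0r.
Qed.

Lemma bproj_ltK n x : (n <= N.+1)%N -> Q n (Q n x) = Q n x.
Proof.
move=> nN; rewrite [LHS]bproj_ltE [RHS]bproj_ltE; apply: eq_bigr => i _.
by rewrite bproj_bproj_lt.
Qed.

Lemma bproj_lt_ltS n x : (n <= N)%N -> Q n (Q n.+1 x) = Q n x.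
Proof.
move=> nN.
by rewrite bproj_ltS linearD/= bproj_ltK ?leqW// bproj_lt_bproj0// addr0.
Qed.

End Blocks.

(** * Block elimination *)

Section Elimination.
Context (R : realType) (k : field_kind).
Local Notation F := (base_field R k).
Context (E : vectType F) (dE : {dot E for field_conj R k}).
Context (H : lmodType F) (dH : {dot H for field_conj R k}) (C : {linear E -> H}).
Context (N : nat) (V : nat -> {vspace E}) (hV : orthogonal_blocks dE N V).
Local Notation b := (bproj N V).
Local Notation Q := (bproj_lt N V).
Local Notation G := (gram dE dH C).
Local Notation Gt := (gram_lt dE dH N V C).
Local Notation B := (blockB dE dH N V C).
Local Notation M := (blockL dE dH N V C).
Local Notation S := (blockS dE dH N V C).
Local Notation U := (blockU dE dH N V C).
Local Notation D := (blockD dE dH N V C).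

Lemma gram_ltE n x : (n <= N.+1)%N -> Gt n x = Q n (G (Q n x)).
Proof.
move=> nN; apply: (dot_ext (dE := dE)) => z.
by rewrite -(bproj_lt_self hV)// gramP [LHS](gramP dE dH (C \o Q n)).
Qed.

Lemma gram_lt_psd n : psd dE (Gt n).
Proof. exact: (gram_psd dE dH (C \o Q n)). Qed.

Lemma gram_lt_proj n x : (n <= N.+1)%N -> Gt n (Q n x) = Gt n x.
Proof. by move=> nN; rewrite !gram_ltE// (bproj_ltK hV). Qed.

Lemma gram_lt_full : Gt N.+1 = G.
Proof. by apply/lfunP => x; rewrite gram_ltE// !(bproj_lt_full hV). Qed.

Lemma gram_lt0 x : Gt 0 x = 0.
Proof. by rewrite gram_ltE// bproj_lt0. Qed.

Lemma blockBE n x : (n <= N)%N -> B n x = Q n (G (b n x)).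
Proof.
move=> nN; rewrite !comp_lfunE gram_ltE// (bproj_lt_ltS hV)//.
by rewrite (bproj_lt_bproj hV).
Qed.

Lemma blockLE n x : M n x = Defs.pinv dE (Gt n) (B n x).
Proof. by rewrite comp_lfunE. Qed.

(** The pseudo-inverse of G_(n-1) has the same range as G_(n-1), which lies in
the blocks before n. *)
Lemma proj_blockL n x : (n <= N)%N -> Q n (M n x) = M n x.
Proof.
move=> nN; have pG := gram_lt_psd n.
rewrite blockLE -[in RHS]pinvXAX// -[in LHS]pinvXAX//; set y := Defs.pinv _ _ _.
apply: (dot_ext (dE := dE)) => z.
rewrite -(bproj_lt_self hV) ?leqW// -!(pinvXA_self pG).
by rewrite gram_lt_proj// leqW.
Qed.

Lemma blockL_bproj n x : (n <= N)%N -> M n (b n x) = M n x.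
Proof. by move=> nN; rewrite !blockLE !blockBE// (bprojK hV). Qed.

Lemma bproj_blockL i n x : (n <= i)%N -> (i <= N)%N -> b i (M n x) = 0.
Proof.
move=> ni iN; rewrite -proj_blockL ?(leq_trans ni)//.
by rewrite (bproj_bproj_lt0 hV).
Qed.

Lemma blockL_bproj0 n x : (n <= N)%N -> b n x = 0 -> M n x = 0.
Proof. by move=> nN bx; rewrite -blockL_bproj// bx linear0. Qed.

Lemma blockLL n x : (n <= N)%N -> M n (M n x) = 0.
Proof. by move=> nN; rewrite blockL_bproj0// bproj_blockL. Qed.

(** The range of B_n lies in that of G_(n-1): with x_n the component of x in block
n, <B_n x, v> = <C x_n, C v> = 0 for each v in the earlier blocks with C v = 0. *)
Lemma gram_lt_blockL n x : (n <= N)%N -> Gt n (M n x) = B n x.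
Proof.
move=> nN; rewrite blockLE; apply: (@gram_pinv _ _ _ dE _ dH (C \o Q n)) => v CQv.
rewrite blockBE// -(bproj_lt_self hV) ?leqW// gramP.
by rewrite (CQv : C (Q n v) = 0) dot0l.
Qed.

Lemma blockS_dot n x y : (n <= N)%N ->
  dE (S n x) y = dE (G (b n x)) (b n y) - dE (M n x) (B n y).
Proof.
move=> nN; rewrite /blockS add_lfunE opp_lfunE !comp_lfunE dotBl; congr (_ - _).
  rewrite gram_ltE// !(bproj_lt_bproj hV)// (bproj_self hV)//.
  by rewrite (bproj_lt_self hV)// (bproj_lt_bproj hV).
by rewrite -adjPC !comp_lfunE.
Qed.

Lemma dot_blockL_blockB n x y : (n <= N)%N ->
  dE (B n x) (M n y) = dE (M n x) (B n y).
Proof. by move=> nN; rewrite -!gram_lt_blockL// (gram_lt_psd n).1. Qed.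

Lemma blockS_self n : (n <= N)%N -> selfadjoint dE (S n).
Proof.
move=> nN x y; rewrite blockS_dot// [RHS]dotC blockS_dot// field_conjD field_conjN.
by rewrite -!dotC dot_blockL_blockB// (gram_psd dE dH C).1.
Qed.

Lemma blockS_bproj n x : (n <= N)%N -> S n (b n x) = S n x.
Proof.
move=> nN; apply: (dot_ext (dE := dE)) => z; rewrite [LHS]dotC [RHS]dotC.
by rewrite !blockS_dot// (bprojK hV)// blockL_bproj.
Qed.

Lemma bproj_blockS n x : (n <= N)%N -> b n (S n x) = S n x.
Proof.
move=> nN; apply: (dot_ext (dE := dE)) => z.
by rewrite -(bproj_self hV)// -!blockS_self// blockS_bproj.
Qed.

Lemma blockS_bproj0 n x : (n <= N)%N -> b n x = 0 -> S n x = 0.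
Proof. by move=> nN bx; rewrite -blockS_bproj// bx linear0. Qed.

Lemma gram_ltS_dot n x y : (n <= N)%N ->
  dE (Gt n.+1 x) y =
  dE (Gt n x) y + dE x (B n y) + (dE (B n x) y + dE (G (b n x)) (b n y)).
Proof.
move=> nN; rewrite gram_ltE// (bproj_lt_self hV)// !bproj_ltS.
rewrite [G (_ + _)]linearD/= dotDl !dotDr.
rewrite gram_ltE ?leqW// !blockBE// !(bproj_lt_self hV) ?leqW//.
rewrite -[dE x (Q n _)](bproj_lt_self hV) ?leqW//.
by rewrite -[dE (Q n x) (G _)](gram_psd dE dH C).1.
Qed.

(** The identity G_n = (1 + L_n)* (G_(n-1) + S_n) (1 + L_n), with G_(n-1) written
Gt n and L_n written M n. Since G_(n-1) L_n = B_n, the right-hand side expands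
to the four blocks of G_n; the terms <L_n x, B_n y>, from L_n* B_n and from the
Schur complement, cancel. *)
Lemma block_step n x y : (n <= N)%N ->
  dE (Gt n.+1 x) y = dE (Gt n (x + M n x) + S n (x + M n x)) (y + M n y).
Proof.
move=> nN; have SM u v : dE (S n u) (M n v) = 0.
  by rewrite blockS_self// [S n _]blockS_bproj0 ?bproj_blockL// dot0r.
rewrite gram_ltS_dot// !linearD/= gram_lt_blockL//.
rewrite [S n (M n x)]blockS_bproj0 ?bproj_blockL//.
rewrite addr0 [dE (_ + _ + _) (M n y)]dotDl SM addr0 !dotDl.
rewrite blockS_dot// (gram_lt_psd n).1.
rewrite [dE (Gt n x) (M n y)](gram_lt_psd n).1 gram_lt_blockL//.
rewrite dot_blockL_blockB//; ring.
Qed.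

(** As L_n^2 = 0, 1 - L_n inverts 1 + L_n. Hence the form of S_n is that of G_n
pulled back, which makes it positive. *)
Lemma blockS_gram n x y : (n <= N)%N ->
  dE (S n x) y = dE (Gt n.+1 (b n x - M n x)) (b n y - M n y).
Proof.
move=> nN; have cancel u : b n u - M n u + M n (b n u - M n u) = b n u.
  by rewrite linearB/= blockL_bproj// blockLL// subr0 subrK.
rewrite block_step// !cancel gram_ltE ?leqW// (bproj_lt_bproj0 hV)// !linear0 add0r.
by rewrite blockS_bproj// [RHS]blockS_self// blockS_bproj// -blockS_self.
Qed.

Lemma blockS_psd n : (n <= N)%N -> psd dE (S n).
Proof.
move=> nN; split=> [|x]; first exact: blockS_self.
by rewrite blockS_gram// (gram_lt_psd _).2.
Qed.

Lemma blockUS n x : U n.+1 x = U n (x + M n.+1 x).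
Proof. by rewrite /= comp_lfunE add_lfunE id_lfunE. Qed.

Lemma blockU0 x : U 0 x = x.
Proof. by rewrite id_lfunE. Qed.

Lemma bproj_blockU_gt m n x : (n < m)%N -> (m <= N)%N -> b m (U n x) = b m x.
Proof.
move=> nm mN; elim: n x nm => [|n IH] x nm; first by rewrite blockU0.
by rewrite blockUS IH ?(ltnW nm)// linearD/= bproj_blockL ?addr0 ?(ltnW nm).
Qed.

(** The factor 1 + L_m changes only vectors with a component in block m, and only
their components in the blocks before m. *)
Lemma bproj_blockU_lt i j n x : (j <= i)%N -> (i <= N)%N -> (n <= N)%N ->
  b i (U n (Q j x)) = 0.
Proof.
move=> ji iN; elim: n j x ji => [|n IH] j x ji nN.
  by rewrite blockU0 (bproj_bproj_lt0 hV).
rewrite blockUS linearD linearD/= IH ?(ltnW nN)// add0r.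
have [nj|jn] := ltnP n.+1 j.
  by rewrite -proj_blockL// IH ?(ltnW nN)// (leq_trans (ltnW nj)).
by rewrite blockL_bproj0 ?linear0// (bproj_bproj_lt0 hV).
Qed.

Lemma bproj_blockU_bproj i n x : (i <= N)%N -> (n <= N)%N -> b i (U n (b i x)) = b i x.
Proof.
move=> iN; elim: n => [|n IH] nN; first by rewrite blockU0 (bprojK hV).
rewrite blockUS linearD linearD/= IH ?(ltnW nN)//.
have [ni|ni] := eqVneq n.+1 i.
  have ni' : (n.+1 <= i)%N by rewrite ni.
  by rewrite -proj_blockL// (bproj_blockU_lt _ ni' iN (ltnW nN)) addr0.
by rewrite [M _ _]blockL_bproj0 ?linear0 ?addr0// (bproj_bproj hV).
Qed.

Lemma blockU_inj n x : (n <= N)%N -> U n x = 0 -> x = 0.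
Proof.
elim: n x => [|n IH] x nN; first by rewrite blockU0.
rewrite blockUS => /(IH _ (ltnW nN)) xM; have Mx : M n.+1 x = 0.
  by have := congr1 (M n.+1) xM; rewrite linearD/= blockLL// addr0 linear0.
by rewrite Mx addr0 in xM.
Qed.

Lemma lker_blockU n : (n <= N)%N -> lker (U n) == 0%VS.
Proof.
move=> nN; rewrite -subv0; apply/subvP => x; rewrite memv_ker memv0.
by move=> /eqP/blockU_inj ->.
Qed.

(** Iterate [block_step]: U_(n-1) fixes block n, so S_n passes through it. *)
Lemma block_factorization n x y : (n <= N)%N ->
  dE (Gt n.+1 x) y = dE (\sum_(i < n.+1) S i (U n x)) (U n y).
Proof.
elim: n x y => [|n IH] x y nN.
  rewrite block_step// big_ord1 !blockU0 gram_lt0 add0r.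
  by rewrite ![M 0 _]blockLE !blockBE// !bproj_lt0 !linear0 !addr0.
rewrite block_step// big_ord_recr/= [RHS]dotDl !dotDl !blockUS -IH ?(ltnW nN)//.
congr (_ + _); rewrite -[S n.+1 (U n _)]blockS_bproj// bproj_blockU_gt// blockS_bproj//.
rewrite -[in RHS]bproj_blockS// [RHS](bproj_self hV)// bproj_blockU_gt//.
by rewrite -[RHS](bproj_self hV)// bproj_blockS.
Qed.

Lemma blockDE x : D x = \sum_(i < N.+1) S i x.
Proof. by rewrite /blockD sum_lfunE. Qed.

Lemma blockD_psd : psd dE D.
Proof.
split=> [x y|x]; rewrite !blockDE.
  rewrite dot_suml dot_sumr; apply: eq_bigr => i _.
  by apply: blockS_self; rewrite -ltnS.
by rewrite dot_suml sumr_ge0// => i _; apply: (blockS_psd _).2; rewrite -ltnS.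
Qed.

Lemma gram_blockD x y : dE (G x) y = dE (D (U N x)) (U N y).
Proof. by rewrite -gram_lt_full block_factorization// blockDE. Qed.

Lemma gram_factorization : G = (adj dE (U N) \o D \o U N)%VF.
Proof.
apply/lfunP => x; apply: (dot_ext (dE := dE)) => z; rewrite !comp_lfunE -adjP.
by rewrite -blockD_psd.1 -gram_blockD (gram_psd dE dH C).1.
Qed.

Lemma blockD_diag i j : (i <= N)%N -> (j <= N)%N ->
  (b i \o D \o b j)%VF = if i == j then S i else 0.
Proof.
move=> iN jN; apply/lfunP => x; rewrite !comp_lfunE blockDE linear_sum.
have jlt : (j < N.+1)%N by [].
rewrite (bigD1 (Ordinal jlt))//= big1 ?addr0; last first.
  move=> l lj; rewrite blockS_bproj0 ?linear0 ?leq_ord//.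
  by rewrite (bproj_bproj hV) ?leq_ord.
rewrite blockS_bproj//; case: eqVneq => [->|ij]; first by rewrite bproj_blockS.
by rewrite zero_lfunE -bproj_blockS// (bproj_bproj hV).
Qed.

End Elimination.

(** * kappa from the block factors *)

Section BlockKappa.
Context (R : realType) (k : field_kind).
Local Notation F := (base_field R k).
Context (E : vectType F) (dE : {dot E for field_conj R k}).
Context (H : normedModType F) (dH : {dot H for field_conj R k}).
Context (hH : hilbert_norm dH).
Context (Z : normedModType F) (C : {linear E -> H}) (L : {linear E -> Z}).
Context (N : nat) (V : nat -> {vspace E}) (hV : orthogonal_blocks dE N V).
Local Notation G := (gram dE dH C).
Local Notation U := (blockU dE dH N V C N).
Local Notation D := (blockD dE dH N V C).

Let U_ker : lker U == 0%VS.
Proof. exact: lker_blockU. Qed.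

Lemma blockUK x : (U^-1)%VF (U x) = x.
Proof. exact: (lker0_lfunK U_ker). Qed.

Lemma blockUVK x : U ((U^-1)%VF x) = x.
Proof. exact: (lker0_lfunVK U_ker). Qed.

Lemma blockDU_eq0 x : D (U x) = 0 <-> C x = 0.
Proof.
rewrite -(gram_eq0 dE dH); split=> [DU|Gx]; apply: (dot_ext (dE := dE)) => z.
  by rewrite dotC (gram_blockD dH C hV) DU !dot0l field_conj0 dot0r.
by rewrite -[z]blockUVK dotC -(gram_blockD dH C hV) Gx dot0l field_conj0 dot0r.
Qed.

Lemma ker_sub_block : ker_sub C L <-> (forall x, D x = 0 -> L ((U^-1)%VF x) = 0).
Proof.
split=> [CL x Dx|DL x /blockDU_eq0 /DL]; last by rewrite blockUK.
by apply/CL/blockDU_eq0; rewrite blockUVK.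
Qed.

(** [least_decoder] with T = U^-1 D^(dagger/2): C T is a contraction since
|C T x|^2 = <D D^(dagger/2) x, D^(dagger/2) x>, and T T* C* C = U^-1 D^dagger D U
differs from the identity by vectors of ker C. *)
Lemma kappa_block : ker_sub C L -> kappa dE dH C L =
  opnorm (dotnorm dE) (@rnorm R k Z) (fun x => L ((U^-1)%VF (pinv_half dE D x))).
Proof.
move=> CL; have [kmem kmin] := kappa_least dE hH CL; have pD := blockD_psd dH C hV.
pose T := ((U^-1)%VF \o pinv_half dE D)%VF.
have TE x : T x = (U^-1)%VF (pinv_half dE D x) by rewrite comp_lfunE.
have -> :
    (fun x => L ((U^-1)%VF (pinv_half dE D x))) = (fun x => L (T x)).
  by apply/funext => x; rewrite TE.
have [|x|Tmem Tmin] := @least_decoder _ _ _ dE _ dH hH _ C L T.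
- move=> x; rewrite -(gramP dE) -(gram_psd dE dH C).1 (gram_blockD dH C hV) TE.
  rewrite blockUVK.
  exact: pinv_half_contraction.
- have -> : adj dE T (G x) = pinv_half dE D (D (U x)).
    apply: (dot_ext (dE := dE)) => z; rewrite -adjP -(gram_psd dE dH C).1.
    rewrite (gram_blockD dH C hV) TE blockUVK pD.1.
    by rewrite (pinv_half_self pD).
  rewrite TE (pinv_halfK pD); apply/esym/eqP; rewrite -subr_eq0 -linearB; apply/eqP.
  rewrite -{1}[x]blockUK -linearB; apply: (ker_sub_block.1 CL).
  by rewrite linearB/= (pinvAXA pD) subrr.
by apply/le_anti; rewrite kmin// Tmin.
Qed.

End BlockKappa.

(** * Limits in terms of real norms *)

Section Cvg.
Context (R : realType) (k : field_kind).
Local Notation F := (base_field R k).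

Lemma pos_rincl (e : F) : 0 < e -> exists2 r : R, 0 < r & e = rincl r.
Proof.
move=> e0; exists (field_re e); last exact/ge0_rincl/ltW.
by rewrite -(@rincl_lt R k) rincl0 -ge0_rincl// ltW.
Qed.

Lemma cvg_rnorm (Z : normedModType F) (u : nat -> Z) (l : Z) :
  u n @[n --> \oo] --> l ->
  forall e : R, 0 < e -> exists N, forall n, (N <= n)%N -> rnorm (l - u n) < e.
Proof.
move=> /cvgrPdist_lt ul e e0.
have [|N _ uN] := ul (rincl e); first by rewrite -(rincl0 R k) rincl_lt.
by exists N => n Nn; rewrite -(@rincl_lt R k) -rnormE; exact: uN.
Qed.

Lemma rnorm_cauchy_cvg (Z : completeNormedModType F) (u : nat -> Z) :
  (forall e : R, 0 < e ->
     exists N, forall n, (N <= n)%N -> rnorm (u n - u N) < e) ->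
  cvg (u n @[n --> \oo]).
Proof.
move=> uC; apply: cauchy_cvg; apply: cauchy_exP.
move=> _ /pos_rincl[e e0 ->]; have [N uN] := uC e e0.
exists (u N), N => // n Nn.
by rewrite -ball_normE /= distrC rnormE rincl_lt uN.
Qed.

Lemma rnorm_cvg_uniq (Z : normedModType F) (u : nat -> Z) (l l' : Z) :
  u n @[n --> \oo] --> l -> u n @[n --> \oo] --> l' -> l = l'.
Proof. by move=> ul ul'; rewrite -(cvg_lim _ ul)// (cvg_lim _ ul'). Qed.

Lemma dense_linear_eq0 (E Z : normedModType F) (h : {linear E -> Z}) (K : R)
    (A : set E) :
  (forall x, rnorm (h x) <= K * rnorm x) -> dense A ->
  (forall x, A x -> h x = 0) ->
  forall x, h x = 0.
Proof.
move=> hK dA hA x; apply: rnorm_eq0; apply/eqP/negPn/negP => hx0.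
have hx : 0 < rnorm (h x) by rewrite lt_neqAle eq_sym hx0 rnorm_ge0.
have K1 : 0 < `|K| + 1 by rewrite ltr_wpDl.
pose e := rnorm (h x) / (`|K| + 1); have e0 : 0 < e by rewrite divr_gt0.
have e0' : 0 < rincl e :> F by rewrite -(rincl0 R k) rincl_lt.
have [|y [xy Ay]] := dA (ball x (rincl e)) _ (ball_open x (rincl e)).
  by exists x; exact: ballxx.
move: xy; rewrite -ball_normE /= rnormE rincl_lt ltr_pdivlMr// => xy.
have := hK (x - y); rewrite linearB/= (hA y Ay) subr0 leNgt => /negP; apply.
apply: le_lt_trans xy; rewrite mulrC ler_wpM2l ?rnorm_ge0//.
by rewrite (le_trans (ler_norm K))// lerDl.
Qed.
End Cvg.

(** * Increasing families of finite-dimensional subspaces *)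

Section Projection.
Context (R : realType) (k : field_kind).
Local Notation F := (base_field R k).
Context (E : vectType F) (dE : {dot E for field_conj R k}).
Context (H : lmodType F) (dH : {dot H for field_conj R k}) (C : {linear E -> H}).

(** The minimal-norm least-squares solution: C (lsq y) is the orthogonal
projection of y onto the range of C. *)
Definition lsq (y : H) : E :=
  Defs.pinv dE (gram dE dH C) (adjoint dE dH C y).

Lemma lsq_linear : linear lsq.
Proof. by move=> a u v; rewrite /lsq (adjoint_linear dE dH C) linearP. Qed.

Lemma lsq_ortho y x : dH (C x) (C (lsq y)) = dH (C x) y.
Proof.
rewrite -(gramP dE) gram_pinv -?adjointP// => v Cv.
by rewrite -adjointP Cv dot0l.
Qed.

End Projection.

Section Global.
Context (R : realType) (k : field_kind).
Local Notation F := (base_field R k).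
Context (H : normedModType F) (dH : {dot H for field_conj R k}).
Context (hH : hilbert_norm dH).
Context (Z : completeNormedModType F) (E : normedModType F).
Context (EN : nat -> vectType F) (dEN : forall n, {dot EN n for field_conj R k}).
Context (iota : forall n, {linear EN n -> E}).
Context (J : {linear E -> H}) (L : {linear E -> Z}).
Context (iota_sub : forall n, range (iota n) `<=` range (iota n.+1)).
Context (dense_iota : dense (\bigcup_n range (iota n))).
Context (bJ : bounded_op J) (bL : bounded_op L).

Local Notation kap n := (kappa (dEN n) dH (J \o iota n) (L \o iota n)).
Local Notation sup_kap := (ereal_sup (range (fun n => kap n))).

Lemma iota_lift m n (x : EN m) : (m <= n)%N -> exists y : EN n, iota n y = iota m x.
Proof.
move=> mn; suff : range (iota n) (iota m x) by case=> y _; exists y.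
elim: n mn => [|n IH]; first by rewrite leqn0 => /eqP m0; subst m; exists x.
rewrite leq_eqVlt => /predU1P[mn|/IH/iota_sub//]; by subst m; exists x.
Qed.

Lemma kappa_iota_least n : ker_sub (J \o iota n) (L \o iota n) ->
  is_least (decoder_norms (J \o iota n) (L \o iota n)) (kap n).
Proof.
exact: (@kappa_least _ _ _ (dEN n) _ dH hH _ (J \o iota n) (L \o iota n)).
Qed.

Lemma kappa_le_decoder n (D : {linear H -> Z}) : bounded_op D ->
  (forall x, D (J (iota n x)) = L (iota n x)) ->
  (kap n <= opnorm (@rnorm R k H) (@rnorm R k Z) D)%E.
Proof.
move=> bD DJ.
have CL : ker_sub (J \o iota n) (L \o iota n).
  by move=> x /= Jx; rewrite -DJ Jx linear0.
have [_ kmin] := kappa_iota_least CL.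
by apply: kmin; exists D.
Qed.

(** A decoder for a larger space is a decoder for the smaller ones. *)
Lemma kappa_homo : {homo (fun n => kap n) : m n / (m <= n)%N >-> (m <= n)%E}.
Proof.
move=> m n mn.
have [CL|CL] := pselect (ker_sub (J \o iota n) (L \o iota n)); last first.
  by rewrite [leRHS]kappa_pinfty// leey.
have [[D [bD DJ ->]] _] := kappa_iota_least CL.
by apply: kappa_le_decoder => // x; have [y <-] := iota_lift x mn; exact: DJ.
Qed.

Lemma kappa_bound (s : R) n x : (kap n <= s%:E)%E ->
  rnorm (L (iota n x)) <= s * rnorm (J (iota n x)).
Proof.
have [CL|CL] := pselect (ker_sub (J \o iota n) (L \o iota n)); last first.
  by rewrite kappa_pinfty.
have [[D [bD DJ ->]] _] := kappa_iota_least CL.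
by move=> /opnorm_bound Ds; rewrite -[L _]DJ; exact: Ds.
Qed.

Lemma stable_kappa_le c n : (forall x, rnorm (L x) <= c * rnorm (J x)) ->
  (kap n <= `|c|%:E)%E.
Proof.
move=> Lc; have CL : ker_sub (J \o iota n) (L \o iota n).
  move=> x /= Jx; apply: rnorm_eq0; apply/eqP; rewrite eq_le rnorm_ge0 andbT.
  by rewrite (le_trans (Lc _))// Jx rnorm0 mulr0.
rewrite kappaE//; apply: opnorm_le => x x1; rewrite lee_fin (le_trans (Lc _))//.
rewrite -[leRHS]mulr1 (le_trans (ler_wpM2r (rnorm_ge0 _) (ler_norm c)))//.
rewrite ler_wpM2l// (hilbert_rnorm hH) (le_trans _ x1)// dotnorm_mono.
exact: (@gram_half_contraction _ _ _ (dEN n) _ dH (J \o iota n)).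
Qed.

Section LimitDecoder.
Context (s : R) (s0 : 0 <= s).
Context (Ls : forall n x, rnorm (L (iota n x)) <= s * rnorm (J (iota n x))).

(* P n is the orthogonal projection onto J (E_n), and Dn n the optimal decoder
   at level n. *)
Let xn n y : EN n := lsq (dEN n) dH (J \o iota n) y.
Let P n y : H := J (iota n (xn n y)).
Let Dn n y : Z := L (iota n (xn n y)).

Let P_ortho n y x : dH (J (iota n x)) (P n y) = dH (J (iota n x)) y.
Proof. exact: (@lsq_ortho _ _ _ (dEN n) _ dH (J \o iota n)). Qed.

Let P_step m n y : (m <= n)%N ->
  dH (P n y) (P n y) =
  dH (P m y) (P m y) + dH (P n y - P m y) (P n y - P m y).
Proof.
move=> mn; have orth : dH (P m y) (P n y - P m y) = 0.
  rewrite dotBr P_ortho {1}/P; have [z <-] := iota_lift (xn m y) mn.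
  by rewrite P_ortho subrr.
by rewrite -(dot_pythagoras orth) [P m y + (_ - _)]addrC subrK.
Qed.

Let P_le n y : dH (P n y) (P n y) <= dH y y.
Proof.
have orth : dH (P n y) (y - P n y) = 0 by rewrite dotBr P_ortho subrr.
have /esym := dot_pythagoras orth; rewrite [P n y + _]addrC subrK => <-.
by rewrite lerDl dot_ge0.
Qed.

Let Dn_le m n y : (m <= n)%N ->
  rnorm (Dn n y - Dn m y) <= s * rnorm (P n y - P m y).
Proof.
move=> mn; rewrite /Dn /P; have [z <-] := iota_lift (xn m y) mn.
by rewrite -!linearB; exact: Ls.
Qed.

Let Dn_cauchy y (e : R) : 0 < e ->
  exists N, forall n, (N <= n)%N -> rnorm (Dn n y - Dn N y) < e.
Proof.
(* The squared norms of P n y are nondecreasing and bounded by that of y. Past an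
   index N where they are within d of their supremum, P n y - P N y has squared
   norm below d; d is chosen so that the factor s of Dn_le is absorbed, with
   s + 1 in place of s to divide by a positive number. *)
move=> e0; pose u n := rnorm (P n y) ^+ 2; pose S := sup (range u).
have uE n : rincl (u n) = dH (P n y) (P n y).
  by rewrite /u (hilbert_rnorm hH) dotnorm_sqr -dot_rincl.
have hu : has_sup (range u).
  split; first by exists (u 0%N), 0%N.
  exists (rnorm y ^+ 2) => _ [n _ <-].
  by rewrite -(@rincl_le R k) uE (hilbert_rnorm hH) dotnorm_sqr -dot_rincl.
pose d := (e / (s + 1)) ^+ 2.
have s1 : 0 < s + 1 by rewrite ltr_wpDl.
have d0 : 0 < d by rewrite exprn_gt0// divr_gt0.
have [_ [N _ <-] uN] := sup_adherent d0 hu; exists N => n Nn.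
have : rnorm (P n y - P N y) ^+ 2 < d.
  have -> : rnorm (P n y - P N y) ^+ 2 = u n - u N.
    apply/(can_inj (@rincl_re R k)).
    rewrite (hilbert_rnorm hH) dotnorm_sqr -dot_rincl.
    apply/(addrI (rincl (u N))).
    by rewrite -rinclD [u N + _]addrC subrK !uE -P_step.
  rewrite ltrBlDr; apply: le_lt_trans (_ : S < _); last by rewrite -ltrBlDl.
  by apply: ub_le_sup; [case: hu|exists n].
rewrite ltr_pXn2r ?nnegrE ?rnorm_ge0 ?divr_ge0 ?(ltW e0) ?(ltW s1)//.
rewrite ltr_pdivlMr//.
apply: le_lt_trans; apply: le_trans (Dn_le y Nn) _.
by rewrite mulrC ler_wpM2l ?rnorm_ge0// lerDl.
Qed.

(** The pointwise limit D of the Dn n. It satisfies D J = L on each E_n, where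
Dn m J = L as soon as m >= n, and hence on E by density. *)
Lemma limit_decoder : exists D : {linear H -> Z},
  (forall y, rnorm (D y) <= s * rnorm y) /\ forall x, D (J x) = L x.
Proof.
pose D y := lim (Dn n y @[n --> \oo]).
have DnD y : Dn n y @[n --> \oo] --> D y.
  by apply: rnorm_cauchy_cvg; exact: Dn_cauchy.
have Dn_lin n : linear (Dn n).
  move=> a u v.
  by rewrite /Dn /xn (lsq_linear (dEN n) dH (J \o iota n)) !linearP.
have lD : linear D.
  move=> a u v; apply: rnorm_cvg_uniq (DnD _) _.
  have -> : (fun n => Dn n (a *: u + v)) = (fun n => a *: Dn n u + Dn n v).
    by apply/funext => n; rewrite Dn_lin.
  apply: cvgD (DnD v); exact: cvgZl_tmp (DnD u).
have DJ n x : D (J (iota n x)) = L (iota n x).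
  apply: rnorm_cvg_uniq (DnD _) _; apply: cvg_near_cst; exists n => // m /= nm.
  have [z zx] := iota_lift x nm; rewrite -zx; apply/eqP.
  rewrite -subr_eq0 -!linearB.
  apply/eqP/rnorm_eq0/eqP; rewrite eq_le rnorm_ge0 andbT (le_trans (Ls _))//.
  rewrite [X in rnorm X](_ : _ = 0) ?rnorm0 ?mulr0//.
  apply: (@dot_eq0 _ _ _ dH).
  set y := J (iota m z); set w := xn m y - z.
  have wE : J (iota m w) = P m y - y by rewrite /w !linearB.
  by rewrite {2}wE dotBr P_ortho subrr.
have Ds y : rnorm (linear_of lD y) <= s * rnorm y.
  apply/ler_addgt0Pr => e e0; have [N DN] := cvg_rnorm (DnD y) e0.
  rewrite -[linear_of lD y](subrK (Dn N y)) (le_trans (rnorm_triangle _ _))// addrC.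
  rewrite lerD ?(ltW (DN N _))// (le_trans (Ls _))// ler_wpM2l//.
  by rewrite !(hilbert_rnorm hH) dotnorm_mono P_le.
exists (linear_of lD); split=> // x; apply/eqP; rewrite -subr_eq0; apply/eqP.
have [cJ [_ cJ0 cJP]] := bounded_opP bJ; have [cL [_ cL0 cLP]] := bounded_opP bL.
apply: (@dense_linear_eq0 _ _ _ _ ((linear_of lD \o J) \- L) (s * cJ + cL) _ _
  dense_iota _ x).
  move=> z; rewrite (le_trans (rnorm_triangle _ _))// rnormN mulrDl lerD//.
  by rewrite (le_trans (Ds _))// -mulrA ler_wpM2l.
by move=> _ [n _ [z _ <-]]; rewrite /= DJ subrr.
Qed.
End LimitDecoder.

Lemma sup_kappa_ge0 : (0 <= sup_kap)%E.
Proof.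
apply: le_trans (ereal_sup_ubound (ex_intro2 _ _ 0%N I erefl)).
exact: (@kappa_ge0 _ _ _ (dEN 0%N) _ dH hH _ (J \o iota 0) (L \o iota 0)).
Qed.

Lemma kappa_le_sup n : (kap n <= sup_kap)%E.
Proof. by apply: ereal_sup_ubound; exists n. Qed.

Lemma sup_kappa_le_decoder a : decoder_norms J L a -> (sup_kap <= a)%E.
Proof.
move=> [D [bD DJ ->]]; apply: ge_ereal_sup => _ [n _ <-].
by apply: kappa_le_decoder => // x; exact: DJ.
Qed.

Lemma sup_kappa_decoder : (sup_kap < +oo)%E ->
  exists (s : R) (D : {linear H -> Z}),
  [/\ sup_kap = s%:E, 0 <= s, forall y, rnorm (D y) <= s * rnorm y
    & forall x, D (J x) = L x].
Proof.
have := sup_kappa_ge0; have := kappa_le_sup.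
case: sup_kap => [s sup_s|//|//]; rewrite lee_fin => s0 _.
have [|D [Ds DJ]] := @limit_decoder s s0; last by exists s, D.
by move=> n x; apply/kappa_bound/sup_s.
Qed.

Lemma sup_kappa_least : (sup_kap < +oo)%E -> is_least (decoder_norms J L) sup_kap.
Proof.
move=> /sup_kappa_decoder[s [D [sE s0 Ds DJ]]]; split; last exact: sup_kappa_le_decoder.
have Dle : (opnorm (@rnorm R k H) (@rnorm R k Z) D <= sup_kap)%E.
  by rewrite sE; exact: opnorm_leP.
have bD : bounded_op D by rewrite /bounded_op (le_lt_trans Dle)// sE ltry.
exists D; split=> //; apply/le_anti; rewrite Dle sup_kappa_le_decoder//.
by exists D.
Qed.

Lemma stableP : stably_recoverable J L <-> (sup_kap < +oo)%E.
Proof.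
split=> [[c Lc]|/sup_kappa_decoder[s [D [_ s0 Ds DJ]]]]; last first.
  by exists s => x; rewrite -DJ; exact: Ds.
apply: le_lt_trans (ltry `|c|); apply: ge_ereal_sup => _ [n _ <-].
exact: stable_kappa_le.
Qed.

Lemma sup_kappa_inf : sup_kap = ereal_inf (decoder_norms J L).
Proof.
apply/le_anti; rewrite le_ereal_inf_tmp/=; last exact: sup_kappa_le_decoder.
have [/sup_kappa_least[+ _]|] := ltP sup_kap +oo%E; first exact: ereal_inf_lbound.
by rewrite leye_eq => /eqP ->; rewrite leey.
Qed.

Lemma optimal_error_sup delta : 0 < delta ->
  optimal_error J L delta = (delta%:E * sup_kap)%E.
Proof.
move=> d0; apply/le_anti/andP; split; last first.
  apply: le_ereal_inf_tmp => _ [Dec _ <-]; rewrite -lee_pdivlMl//.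
  apply: ge_ereal_sup => _ [n _ <-]; rewrite lee_pdivlMl//.
  apply: le_trans
    (@kappa_risk _ _ _ (dEN n) _ dH hH _ (J \o iota n) (L \o iota n) delta Dec
      d0) _.
  apply: ge_ereal_sup => _ [[x e] /= ed <-].
  exact: (worst_error_ub J L Dec (iota n x) ed).
have [/sup_kappa_decoder[s [D [-> s0 Ds DJ]]]|] := ltP sup_kap +oo%E; last first.
  by rewrite leye_eq => /eqP ->; rewrite gt0_muley// leey.
rewrite -EFinM; apply: le_trans (worst_error_decoder _ s0 DJ Ds).
by apply: ereal_inf_lbound; exists D.
Qed.

End Global.

(** * The recovery theorem *)

Theorem proposition7p4 (R : realType) (k : field_kind)
    (H : completeNormedModType (base_field R k))
    (dH : {dot H for field_conj R k}) (hH : hilbert_norm dH)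
    (Z : completeNormedModType (base_field R k)) :
  (forall (E : vectType (base_field R k)) (dE : {dot E for field_conj R k})
      (N : nat) (V : nat -> {vspace E}) (C : {linear E -> H})
      (L : {linear E -> Z}),
    orthogonal_blocks dE N V ->
    let G := gram dE dH C in
    let D := blockD dE dH N V C in
    let U := blockU dE dH N V C N in
    [/\ [/\ G = (adj dE U \o D \o U)%VF,
            psd dE D,
            forall i j : nat, (i <= N)%N -> (j <= N)%N ->
              (bproj N V i \o D \o bproj N V j)%VF
                = if i == j then blockS dE dH N V C i else 0,
            forall i j : nat, (j < i)%N -> (i <= N)%N ->
              (bproj N V i \o U \o bproj N V j)%VF = 0
          & forall i : nat, (i <= N)%N ->
              (bproj N V i \o U \o bproj N V i)%VF = bproj N V i],
        [/\ (U \o U^-1)%VF = \1%VF, (U^-1 \o U)%VF = \1%VF,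
            exactly_recoverable C L <-> ker_sub C L
          & ker_sub C L <-> (forall x, D x = 0 -> L ((U^-1)%VF x) = 0)],
        ker_sub C L ->
          [/\ is_least (decoder_norms C L) (kappa dE dH C L),
              kappa dE dH C L = opnorm (dotnorm dE) (@rnorm R k Z)
                (fun x => L ((U^-1)%VF (pinv_half dE D x)))
            & kappa dE dH C L = opnorm (dotnorm dE) (@rnorm R k Z)
                (fun x => L (pinv_half dE G x))],
        forall delta : R, 0 < delta ->
          optimal_error C L delta = (delta%:E * kappa dE dH C L)%E
      & ~ ker_sub C L ->
          kappa dE dH C L = +oo%E /\
          forall Dec : H -> Z, worst_error C L 0 Dec = +oo%E])
  /\
  (forall (E : completeNormedModType (base_field R k))
      (dE : {dot E for field_conj R k}) (hE : hilbert_norm dE)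
      (EN : nat -> vectType (base_field R k))
      (dEN : forall n, {dot EN n for field_conj R k})
      (iota : forall n, {linear EN n -> E})
      (J : {linear E -> H}) (L : {linear E -> Z}),
    (forall n x y, dE (iota n x) (iota n y) = dEN n x y) ->
    (forall n, range (iota n) `<=` range (iota n.+1)) ->
    dense (\bigcup_n range (iota n)) ->
    bounded_op J -> bounded_op L ->
    let kap n := kappa (dEN n) dH (J \o iota n) (L \o iota n) in
    let sup_kap := ereal_sup (range kap) in
    [/\ stably_recoverable J L <-> (sup_kap < +oo)%E,
        {homo kap : m n / (m <= n)%N >-> (m <= n)%E},
        sup_kap = ereal_inf (decoder_norms J L),
        (sup_kap < +oo)%E -> is_least (decoder_norms J L) sup_kap
      & forall delta : R, 0 < delta ->
          optimal_error J L delta = (delta%:E * sup_kap)%E]).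
Proof.
split=> [E dE N V C L hV G D U|E dE hE EN dEN iota J L iotaE iota_sub dense_iota
  bJ bL kap sup_kap].
  have U0 : lker U == 0%VS by exact: lker_blockU.
  split.
  - split.
    + exact: gram_factorization.
    + exact: blockD_psd.
    + by move=> i j iN jN; exact: blockD_diag.
    + move=> i j ji iN; apply/lfunP => x; rewrite !comp_lfunE zero_lfunE.
      have jN : (j < N.+1)%N by exact: leqW (leq_trans ji iN).
      by rewrite -(bproj_lt_bproj hV x (ltnSn j) jN) (bproj_blockU_lt dH C hV).
    + move=> i iN; apply/lfunP => x; rewrite !comp_lfunE.
      exact: (bproj_blockU_bproj dH C hV).
  - split; [exact: lker0_compfV|exact: lker0_compVf|exact: exactly_recoverableP
           |exact: ker_sub_block].
  - move=> CL; split; [exact: kappa_least|exact: kappa_block|exact: kappaE].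
  - by move=> delta; exact: optimal_error_kappa.
  - move=> CL; split; first exact: kappa_pinfty.
    by move=> Dec; exact: worst_error_incompatible.
rewrite /sup_kap /kap; split.
- exact: (@stableP R k H dH hH Z E EN dEN iota J L).
- exact: (@kappa_homo R k H dH hH Z E EN dEN iota J L).
- exact: (@sup_kappa_inf R k H dH hH Z E EN dEN iota J L).
- exact: (@sup_kappa_least R k H dH hH Z E EN dEN iota J L).
- by move=> delta; exact: (@optimal_error_sup R k H dH hH Z E EN dEN iota J L).
Qed.
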